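(* For every $a\in\mathbb{Z}$ and all integers $c,d\ge0$ with $c+d\ge1$, $$\lim_{N\to\infty}\frac{2\pi}{N+\frac12}\log\Big|J_{\vec N}\big(W_{a,1,c,d},e^{\frac{2\pi i}{N+1/2}}\big)\Big|=\mathrm{Vol}(\mathbb{S}^3\setminus W_{a,1,c,d}).$$
   Context: For $a\in\mathbb{Z}$, $b\ge1$, $c,d\ge0$ with $c+d\ge1$, the Whitehead chain $W_{a,b,c,d}$ (van der Veen) is the link obtained by stacking $a$ full twists, $b$ belts, $c$ clasps and $d$ mirror clasps on a pair of strands and taking the closure; $W_{0,1,1,0}$ is the Whitehead link. $W_{a,1,c,d}$ is hyperbolic with $\mathrm{Vol}(\mathbb{S}^3\setminus W_{a,1,c,d})=(c+d)v_8$, $v_8$ the volume of the regular ideal octahedron. $J_{\vec N}$ denotes the unnormalized colored Jones polynomial with all components colored by $N$; up to a factor of modulus $1$ at roots of unity it is $$J_{\vec N}(W_{a,1,c,d},t)=\frac{1}{t^{1/2}-t^{-1/2}}\sum_{n=0}^{N-1}\big(t^{\frac{N(2n+1)}{2}}-t^{-\frac{N(2n+1)}{2}}\big)\,t^{an(n+1)}\,\tilde C(n,t;N)^c\,\tilde C(n,t^{-1};N)^d,$$ where $\tilde C(n,t;M)=t^{\frac{M(M-1)}{2}}\sum_{l=0}^{M-1-n}t^{-M(l+n)}\prod_{j=1}^n\frac{(1-t^{M-l-j})(1-t^{l+j})}{1-t^j}$. *)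

(* Defs.v *)
From Stdlib Require Import Reals.
From Coquelicot Require Import Coquelicot.
Open Scope R_scope.

Fixpoint Csum (f : nat -> C) (n : nat) : C :=
  match n with O => RtoC 0 | S k => Cplus (Csum f k) (f k) end.
Fixpoint Cprod (f : nat -> C) (n : nat) : C :=
  match n with O => RtoC 1 | S k => Cmult (Cprod f k) (f k) end.
Fixpoint Cpow (z : C) (n : nat) : C :=
  match n with O => RtoC 1 | S k => Cmult (Cpow z k) z end.

(* Evaluation at t = e^{i th}: the power t^x (x real) is e^{i th x}. *)
Definition texp (th x : R) : C := (cos (th * x), sin (th * x)).

Definition Ctilde (n : nat) (th : R) (M : nat) : C :=
  Cmult (texp th (INR M * (INR M - 1) / 2))
   (Csum (fun l =>
      Cmult (texp th (- (INR M * (INR l + INR n))))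
        (Cprod (fun j0 => let j := INR j0 + 1 in
           Cdiv (Cmult (Cminus 1 (texp th (INR M - INR l - j)))
                       (Cminus 1 (texp th (INR l + j))))
                (Cminus 1 (texp th j))) n))
      (M - n)%nat).

(* J_{vec N}(W_{a,1,c,d}, t) at t = e^{i th}, given by the formula of the
   context (which agrees with the colored Jones polynomial up to a factor of
   modulus 1 at roots of unity). *)
Definition JW (a : Z) (c d N : nat) (th : R) : C :=
  Cmult (Cinv (Cminus (texp th (1/2)) (texp th (-(1/2)))))
   (Csum (fun n =>
      Cmult (Cmult (Cmult
        (Cminus (texp th (INR N * (2 * INR n + 1) / 2))
                (texp th (- (INR N * (2 * INR n + 1) / 2))))
        (texp th (IZR a * INR n * (INR n + 1))))
        (Cpow (Ctilde n th N) c))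
        (Cpow (Ctilde n (- th) N) d)) N).

Definition Lobachevsky (x : R) : R :=
  - RInt_gen (fun t => ln (Rabs (2 * sin t))) (at_right 0) (at_point x).

(* volume of the regular ideal hyperbolic octahedron: 8 Lambda(pi/4) *)
Definition v8 : R := 8 * Lobachevsky (PI / 4).

Definition VolW (a : Z) (c d : nat) : R := INR (c + d) * v8.

(* Main.v *)
(** With g = pi/(2N+1) the root of unity t = e^(4ig) satisfies t^(N+1/2) = 1.
    The reflection l -> N-1-n-l pairs the summands of C~(n,t;N) so that
    C~(n,t;N) is an explicit phase times a positive real S_n, and a
    q-Zeilberger certificate gives the first order recursion
      S_(n+1) sin(g(n+3/2)) = cos(g(n+1/2)) S_n.
    Hence S_n is unimodal with peak at n = N/2, and 4g log S_(N/2) is a Riemann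
    sum of 4 int_0^(pi/4) log cot = 8 Lambda(pi/4) = v8.  All phases combine to
    e^(igBk^2), with k = n - N/2 + 1/4 and B = 4a - (c-d), so up to the factor
    1/sin(2g) the invariant has the modulus of a discrete Fresnel sum
    sum_n w_n e^(igBk^2), where w_n = sin(g(2n+1)) S_n^(c+d) decreases away from
    k = 0.  As for the Fresnel integral, summation by parts leaves only
    nonnegative terms in the sum over |k| <= const N, the remaining terms are
    exponentially small, and cancellation costs at most a power of N. *)

Require Import Defs.
From Stdlib Require Import Reals ZArith Lra Lia Psatz.
From Coquelicot Require Import Coquelicot.
Open Scope R_scope.

(** * The real sums S_n and their recursion *)

(** The upper estimate follows from moduli alone; the obstacle is cancellation in the lower one.
    Heuristically [S_n^(c+d)] behaves near its peak like [exp(-(c+d) g k^2)], so weight and phase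
    [gBk^2] vary on the same scale [k ~ sqrt N]: the terms near the peak share no sign, and the
    lower bound has to come from monotonicity of the weights. The half in [N + 1/2] puts the centre
    a quarter off the integers, so that [|k|] runs through [1/4, 5/4, ...] on one side and
    [3/4, 7/4, ...] on the other. Both starting values satisfy [(x0 - 1/2)^2 = 1/16], and therefore
    one common rotation, by [3gB/16], makes the telescoping angle vanish at the start of both
    halves. The restriction [|k| <= const N] comes from the denominators [sin(gBk)], which increase
    only up to the angle [PI / 2]. *)

Fixpoint rsum (f : nat -> R) (n : nat) : R :=
  match n with O => 0 | S k => rsum f k + f k end.
Fixpoint rprod (f : nat -> R) (n : nat) : R :=
  match n with O => 1 | S k => rprod f k * f k end.

Lemma rsum_ext (f h : nat -> R) (n : nat) :
  (forall i, (i < n)%nat -> f i = h i) -> rsum f n = rsum h n.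
Proof.
  induction n as [|n IH]; intros H; simpl; trivial.
  rewrite IH, (H n); auto with arith.
Qed.

Lemma rsum_plus (f h : nat -> R) (n : nat) :
  rsum (fun i => f i + h i) n = rsum f n + rsum h n.
Proof. induction n as [|n IH]; simpl; [ring | rewrite IH; ring]. Qed.

Lemma rsum_scal (x : R) (f : nat -> R) (n : nat) :
  rsum (fun i => x * f i) n = x * rsum f n.
Proof. induction n as [|n IH]; simpl; [ring | rewrite IH; ring]. Qed.

Lemma rsum_shift (f : nat -> R) (n : nat) :
  rsum f (S n) = f 0%nat + rsum (fun i => f (S i)) n.
Proof.
  induction n as [|n IH]; [simpl; ring|].
  change (rsum f (S (S n))) with (rsum f (S n) + f (S n)).
  rewrite IH; simpl; ring.
Qed.

Lemma rsum_rev (f : nat -> R) (n : nat) :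
  rsum f n = rsum (fun i => f (n - 1 - i)%nat) n.
Proof.
  induction n as [|n IH]; trivial.
  rewrite (rsum_shift (fun i => f (S n - 1 - i)%nat)).
  simpl rsum at 1. rewrite IH.
  replace (S n - 1 - 0)%nat with n by lia.
  rewrite Rplus_comm; f_equal.
  apply rsum_ext; intros i Hi; f_equal; lia.
Qed.

Lemma rsum_telescope (f : nat -> R) (n : nat) :
  rsum (fun i => f (S i) - f i) n = f n - f 0%nat.
Proof. induction n as [|n IH]; simpl; [ring | rewrite IH; ring]. Qed.

Lemma rsum_le (f h : nat -> R) (n : nat) :
  (forall i, (i < n)%nat -> f i <= h i) -> rsum f n <= rsum h n.
Proof.
  induction n as [|n IH]; intros H; simpl; [lra|].
  apply Rplus_le_compat; [apply IH; intros; apply H; lia | apply H; lia].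
Qed.

Lemma rsum_const (x : R) (n : nat) : rsum (fun _ => x) n = INR n * x.
Proof.
  induction n as [|n IH]; [simpl; ring|].
  rewrite S_INR; simpl rsum; rewrite IH; ring.
Qed.

Lemma rsum_add (f : nat -> R) (m n : nat) :
  rsum f (m + n) = rsum f m + rsum (fun i => f (m + i)%nat) n.
Proof.
  induction n as [|n IH]; [rewrite Nat.add_0_r; simpl; ring|].
  rewrite Nat.add_succ_r; simpl; rewrite IH; ring.
Qed.

Lemma rprod_ext (f h : nat -> R) (n : nat) :
  (forall i, (i < n)%nat -> f i = h i) -> rprod f n = rprod h n.
Proof.
  induction n as [|n IH]; intros H; simpl; trivial.
  rewrite IH, (H n); auto with arith.
Qed.

Lemma rprod_mult (f h : nat -> R) (n : nat) :
  rprod (fun i => f i * h i) n = rprod f n * rprod h n.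
Proof. induction n as [|n IH]; simpl; [ring | rewrite IH; ring]. Qed.

Lemma rprod_shift (f : nat -> R) (n : nat) :
  rprod f (S n) = f 0%nat * rprod (fun i => f (S i)) n.
Proof.
  induction n as [|n IH]; [simpl; ring|].
  change (rprod f (S (S n))) with (rprod f (S n) * f (S n)).
  rewrite IH; simpl; ring.
Qed.

Lemma rprod_rev (f : nat -> R) (n : nat) :
  rprod f n = rprod (fun i => f (n - 1 - i)%nat) n.
Proof.
  induction n as [|n IH]; trivial.
  rewrite (rprod_shift (fun i => f (S n - 1 - i)%nat)).
  simpl rprod at 1. rewrite IH.
  replace (S n - 1 - 0)%nat with n by lia.
  rewrite Rmult_comm; f_equal.
  apply rprod_ext; intros i Hi; f_equal; lia.
Qed.

Definition ang (N : nat) : R := PI / (2 * INR N + 1).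

Lemma ang_spec (N : nat) : ang N * (2 * INR N + 1) = PI.
Proof. unfold ang; field; pose proof (pos_INR N); lra. Qed.

Lemma ang_pos (N : nat) : 0 < ang N.
Proof.
  pose proof (pos_INR N); pose proof PI_RGT_0.
  unfold ang; apply Rdiv_lt_0_compat; lra.
Qed.

(** Since [1 - t^x] is [2 sin(2gx)] times a phase at [t = e^(4ig)], this is the product inside
    [Ctilde] with its phases removed. *)
Definition weight (N n l : nat) : R :=
  rprod (fun j => 2 * sin (2 * ang N * (INR N - INR l - (INR j + 1)))
                  * sin (2 * ang N * (INR l + (INR j + 1)))
                  / sin (2 * ang N * (INR j + 1))) n.

(** Signed distance of [l] from the fixed point of the reflection [l -> N-1-n-l]. *)
Definition offset (N n l : nat) : R := INR l - (INR N - 1 - INR n) / 2.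

Definition Smod (N n : nat) : R :=
  rsum (fun l => weight N n l * cos (2 * ang N * offset N n l)) (N - n).

Lemma sin_ang_pos (N : nat) (x : R) :
  0 < x < 2 * INR N + 1 -> 0 < sin (ang N * x).
Proof.
  intros H; pose proof (ang_pos N); pose proof (ang_spec N).
  apply sin_gt_0; [nra|].
  rewrite <- (ang_spec N); apply Rmult_lt_compat_l; lra.
Qed.

(** The hypergeometric ratio in [l]. The form without division stays valid at the end of the range,
    where the last sine on the right vanishes; the telescoping needs exactly this. *)
Lemma weight_step (N n l : nat) :
  weight N n (S l) * (sin (2 * ang N * (INR l + 1))
                      * sin (2 * ang N * (INR N - INR l - 1)))
  = weight N n l * (sin (2 * ang N * (INR l + INR n + 1))
                    * sin (2 * ang N * (INR N - INR l - 1 - INR n))).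
Proof.
  induction n as [|n IH].
  - unfold weight; simpl.
    replace (INR l + 0 + 1) with (INR l + 1) by ring.
    rewrite Rminus_0_r; ring.
  - change (weight N (S n) (S l)) with
      (weight N n (S l) * (2 * sin (2 * ang N * (INR N - INR (S l) - (INR n + 1)))
                  * sin (2 * ang N * (INR (S l) + (INR n + 1)))
                  / sin (2 * ang N * (INR n + 1)))).
    change (weight N (S n) l) with
      (weight N n l * (2 * sin (2 * ang N * (INR N - INR l - (INR n + 1)))
                  * sin (2 * ang N * (INR l + (INR n + 1)))
                  / sin (2 * ang N * (INR n + 1)))).
    rewrite !S_INR.
    replace (INR N - (INR l + 1) - (INR n + 1)) with (INR N - INR l - 1 - (INR n + 1)) by ring.
    replace (INR l + 1 + (INR n + 1)) with (INR l + (INR n + 1) + 1) by ring.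
    replace (INR N - INR l - (INR n + 1)) with (INR N - INR l - 1 - INR n) by ring.
    replace (INR l + (INR n + 1)) with (INR l + INR n + 1) by ring.
    unfold Rdiv.
    set (k := / sin (2 * ang N * (INR n + 1))).
    set (p := sin (2 * ang N * (INR N - INR l - 1 - (INR n + 1)))).
    set (q := sin (2 * ang N * (INR l + INR n + 1 + 1))).
    transitivity (2 * p * q * k * (weight N n (S l) * (sin (2 * ang N * (INR l + 1))
                      * sin (2 * ang N * (INR N - INR l - 1))))); [ring|].
    rewrite IH; ring.
Qed.

(** Combined with [j -> n+1-j], the reflection exchanges the two sines in the numerator. *)
Lemma weight_sym (N n l : nat) : (l < N - n)%nat ->
  weight N n (N - n - 1 - l) = weight N n l.
Proof.
  intros Hl; unfold weight, Rdiv.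
  rewrite !rprod_mult; f_equal.
  rewrite !Rmult_assoc; f_equal.
  rewrite Rmult_comm.
  assert (E : INR (N - n - 1 - l) = INR N - INR n - 1 - INR l).
  { rewrite !minus_INR by lia; simpl; ring. }
  f_equal; rewrite rprod_rev; apply rprod_ext; intros i Hi;
    rewrite E, !minus_INR by lia; simpl INR; do 2 f_equal; ring.
Qed.

(** By the symmetry of the weights only the even part of the summand in [offset] matters. *)
Lemma rsum_weight_sym (N n : nat) (f h : R -> R) :
  (forall u, f u + f (- u) = h u + h (- u)) ->
  rsum (fun l => weight N n l * f (offset N n l)) (N - n)
  = rsum (fun l => weight N n l * h (offset N n l)) (N - n).
Proof.
  intros H.
  assert (HR : forall p : R -> R,
    rsum (fun l => weight N n l * p (offset N n l)) (N - n)
    = rsum (fun l => weight N n l * p (- offset N n l)) (N - n)).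
  { intros p; rewrite rsum_rev; apply rsum_ext; intros l Hl.
    rewrite weight_sym by lia; do 2 f_equal.
    unfold offset; rewrite !minus_INR by lia; simpl INR; field. }
  assert (D : forall p : R -> R,
    2 * rsum (fun l => weight N n l * p (offset N n l)) (N - n)
    = rsum (fun l => weight N n l * (p (offset N n l) + p (- offset N n l))) (N - n)).
  { intros p; rewrite <- Rplus_diag; rewrite (HR p) at 2; rewrite <- rsum_plus.
    apply rsum_ext; intros; ring. }
  apply Rmult_eq_reg_l with 2; [|lra].
  rewrite !D; apply rsum_ext; intros; rewrite H; ring.
Qed.

(* Verifies the certificate behind [Smod_step], with [h = ang N],
   [A = ang N * (2n+3)] and [x = 2 * ang N * offset N n l]. *)
Lemma trig_certificate (A h x : R) :
  cos (x - A / 2) * cos (x - A / 2 + h) * sin (A + x - h)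
  + cos (x + A / 2) * cos (x + A / 2 - h) * sin (A - x - h)
  = (cos h + cos (A - h)) * sin (A - h) * cos x.
Proof.
  assert (CC : forall p q, cos p * cos q = (cos (q - p) + cos (p + q)) / 2).
  { intros p q; rewrite cos_minus, cos_plus; field. }
  assert (CS : forall p q, cos p * sin q = (sin (p + q) + sin (q - p)) / 2).
  { intros p q; rewrite sin_minus, sin_plus; field. }
  rewrite !CC.
  replace (x - A / 2 + h - (x - A / 2)) with h by ring.
  replace (x + A / 2 - h - (x + A / 2)) with (- h) by ring.
  replace (x - A / 2 + (x - A / 2 + h)) with (2 * x - (A - h)) by field.
  replace (x + A / 2 + (x + A / 2 - h)) with (2 * x + (A - h)) by field.
  replace (A + x - h) with ((A - h) + x) by ring.
  replace (A - x - h) with ((A - h) - x) by ring.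
  rewrite cos_neg. generalize (A - h); intros D.
  transitivity ((cos h * (sin (D + x) + sin (D - x))
    + (cos (2 * x - D) * sin (D + x) + cos (2 * x + D) * sin (D - x))) / 2); [field|].
  rewrite !CS.
  replace (2 * x - D + (D + x)) with (3 * x) by ring.
  replace (D + x - (2 * x - D)) with (2 * D - x) by ring.
  replace (2 * x + D + (D - x)) with (2 * D + x) by ring.
  replace (D - x - (2 * x + D)) with (- (3 * x)) by ring.
  rewrite sin_neg, !sin_plus, !sin_minus, sin_2a; field.
Qed.

Lemma rsum_weight_telescope (N n : nat) : (n < N)%nat ->
  rsum (fun l => weight N n l *
     (sin (2 * ang N * INR l) * sin (2 * ang N * (INR N - INR l))
        * sin (2 * ang N * (offset N n l - 1/2))
    - sin (2 * ang N * (INR l + INR n + 1)) * sin (2 * ang N * (INR N - INR l - 1 - INR n))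
        * sin (2 * ang N * (offset N n l + 1/2)))) (N - n) = 0.
Proof.
  intros Hn.
  (* The certificate. By [weight_step] the summand is [Q l - Q (S l)], and [Q] vanishes at both ends
     because of a factor [sin 0]. *)
  set (Q := fun l => weight N n l * (sin (2 * ang N * INR l)
     * sin (2 * ang N * (INR N - INR l))) * sin (2 * ang N * (offset N n l - 1/2))).
  assert (HQ : forall l, weight N n l * (sin (2 * ang N * (INR l + INR n + 1))
     * sin (2 * ang N * (INR N - INR l - 1 - INR n)))
        * sin (2 * ang N * (offset N n l + 1/2)) = Q (S l)).
  { intros l; rewrite <- weight_step; unfold Q, offset; rewrite S_INR.
    replace (INR N - (INR l + 1)) with (INR N - INR l - 1) by ring.
    do 2 f_equal. field. }
  transitivity (rsum (fun l => (-1) * (Q (S l) - Q l)) (N - n)).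
  { apply rsum_ext; intros l _; rewrite <- HQ; unfold Q; ring. }
  rewrite rsum_scal, rsum_telescope.
  replace (Q 0%nat) with 0.
  2: { unfold Q; simpl INR; rewrite Rmult_0_r, sin_0; ring. }
  replace (N - n)%nat with (S (N - n - 1)) by lia.
  rewrite <- HQ, !minus_INR by lia; simpl INR.
  replace (INR N - (INR N - INR n - 1) - 1 - INR n) with 0 by ring.
  rewrite Rmult_0_r, sin_0; ring.
Qed.

(** Everything is written as a sum against the weights of level [n]. The symmetrised sum for
    [Smod N (S n)], times [sin A], plus [cos A] times the vanishing telescoping sum is term by term
    a multiple of the sum for [Smod N n]. *)
Lemma Smod_step (N n : nat) : (S n < N)%nat ->
  Smod N (S n) * sin (ang N * (INR n + 3/2)) = cos (ang N * (INR n + 1/2)) * Smod N n.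
Proof.
  intros Hn.
  set (g := ang N). set (A := g * (2 * INR n + 3)).
  pose proof (ang_spec N) as Hpi; fold g in Hpi.
  assert (HN : INR n + 2 <= INR N).
  { replace 2 with (INR 2) by (simpl; ring). rewrite <- plus_INR; apply le_INR; lia. }
  pose proof (pos_INR n) as Hn0.
  set (Xf := fun x => cos (x - A / 2) * cos (x - A / 2 + g)).
  set (Yf := fun x => cos (x + A / 2) * cos (x + A / 2 - g)).
  (* The choice of the root of unity enters here: [g(2N+1) = PI] turns the sines into cosines of the
     centred variable. *)
  assert (HX : forall l, sin (2 * g * INR l) * sin (2 * g * (INR N - INR l))
     = Xf (2 * g * offset N n l)).
  { intros l; unfold Xf; rewrite <- !(sin_shift); unfold offset.
    f_equal; [rewrite <- (sin_PI_x (2 * g * INR l)) | ];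
    f_equal; unfold A; rewrite <- Hpi; field. }
  assert (HY : forall l, sin (2 * g * (INR l + INR n + 1)) * sin (2 * g * (INR N - INR l - 1 - INR n))
     = Yf (2 * g * offset N n l)).
  { intros l; unfold Yf; rewrite <- !(sin_shift); unfold offset.
    rewrite Rmult_comm.
    f_equal; [ | rewrite <- (sin_PI_x (2 * g * (INR l + INR n + 1)))];
    f_equal; unfold A; rewrite <- Hpi; field. }
  assert (Hs : 0 < sin (A - g)).
  { replace (A - g) with (g * (2 * INR n + 2)) by (unfold A; ring).
    apply sin_ang_pos; lra. }
  assert (E1 : Smod N (S n) * sin (A - g) =
     rsum (fun l => weight N n l * (2 * Yf (2 * g * offset N n l) * cos (2 * g * offset N n l + g))) (N - n)).
  (* Level [n] has one more summand than level [n+1]; the extra one is zero because its factor [Yf]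
     vanishes. *)
  { replace (N - n)%nat with (S (N - S n)) by lia.
    simpl rsum at 1. rewrite <- HY at 1.
    replace (INR N - INR (N - S n) - 1 - INR n) with 0.
    2: { rewrite minus_INR, S_INR by lia; ring. }
    rewrite !Rmult_0_r, sin_0, !Rmult_0_r, Rmult_0_l, Rmult_0_r, Rplus_0_r.
    unfold Smod; fold g. rewrite Rmult_comm, <- rsum_scal.
    apply rsum_ext; intros l _; rewrite <- HY.
    change (weight N (S n) l) with
      (weight N n l * (2 * sin (2 * g * (INR N - INR l - (INR n + 1)))
                  * sin (2 * g * (INR l + (INR n + 1)))
                  / sin (2 * g * (INR n + 1)))).
    replace (2 * g * (INR n + 1)) with (A - g) by (unfold A; ring).
    replace (2 * g * offset N (S n) l) with (2 * g * offset N n l + g)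
      by (unfold offset; rewrite S_INR; field).
    replace (INR l + (INR n + 1)) with (INR l + INR n + 1) by ring.
    replace (INR N - INR l - (INR n + 1)) with (INR N - INR l - 1 - INR n) by ring.
    field; lra. }
  assert (E2 : Smod N (S n) * sin (A - g) =
     rsum (fun l => weight N n l * (Yf (2 * g * offset N n l) * cos (2 * g * offset N n l + g)
        + Xf (2 * g * offset N n l) * cos (2 * g * offset N n l - g))) (N - n)).
  { rewrite E1.
    apply (rsum_weight_sym N n
      (fun u => 2 * Yf (2 * g * u) * cos (2 * g * u + g))
      (fun u => Yf (2 * g * u) * cos (2 * g * u + g) + Xf (2 * g * u) * cos (2 * g * u - g))).
    (* [Xf] is the mirror image of [Yf], so half of the sum may be reflected. *)
    intros u; unfold Xf, Yf; rewrite Ropp_mult_distr_r_reverse.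
    set (x := 2 * g * u).
    rewrite <- (cos_neg (- x + A / 2)), <- (cos_neg (- x + A / 2 - g)),
      <- (cos_neg (- x + g)), <- (cos_neg (- x - A / 2)), <- (cos_neg (- x - A / 2 + g)),
      <- (cos_neg (- x - g)).
    replace (- (- x + A / 2)) with (x - A / 2) by ring.
    replace (- (- x + A / 2 - g)) with (x - A / 2 + g) by ring.
    replace (- (- x + g)) with (x - g) by ring.
    replace (- (- x - A / 2)) with (x + A / 2) by ring.
    replace (- (- x - A / 2 + g)) with (x + A / 2 - g) by ring.
    replace (- (- x - g)) with (x + g) by ring.
    ring. }
  assert (E3 : rsum (fun l => weight N n l * (Xf (2 * g * offset N n l) * sin (2 * g * offset N n l - g)
        - Yf (2 * g * offset N n l) * sin (2 * g * offset N n l + g))) (N - n) = 0).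
  { rewrite <- (rsum_weight_telescope N n) at 1 by lia.
    apply rsum_ext; intros l _; fold g; rewrite HX, HY.
    do 3 f_equal; f_equal; field. }
  assert (E4 : Smod N (S n) * sin (A - g) * sin A
      = (cos g + cos (A - g)) * sin (A - g) * Smod N n).
  (* These multipliers merge the cosines of [E2] and the sines of [E3] into [sin(A + x - g)] and
     [sin(A - x - g)], as in [trig_certificate]. *)
  { transitivity (sin A * (Smod N (S n) * sin (A - g)) + cos A * 0); [ring|].
    rewrite <- E3, E2, <- !rsum_scal, <- rsum_plus; unfold Smod; rewrite <- rsum_scal.
    apply rsum_ext; intros l _; fold g.
    set (x := 2 * g * offset N n l).
    transitivity (weight N n l * ((cos g + cos (A - g)) * sin (A - g) * cos x)); [|ring].
    rewrite <- (trig_certificate A g x).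
    replace (A + x - g) with (A + (x - g)) by ring.
    replace (A - x - g) with (A - (x + g)) by ring.
    rewrite (sin_plus A (x - g)), (sin_minus A (x + g)); unfold Xf, Yf; ring. }
  assert (Hc : 0 < cos (A / 2)).
  { rewrite <- sin_shift.
    replace (PI / 2 - A / 2) with (g * (INR N - INR n - 1)) by (unfold A; rewrite <- Hpi; field).
    apply sin_ang_pos; lra. }
  replace (g * (INR n + 3/2)) with (A / 2) by (unfold A; field).
  replace (g * (INR n + 1/2)) with (A / 2 - g) by (unfold A; field).
  apply Rmult_eq_reg_r with (2 * cos (A / 2) * sin (A - g)).
  2: { apply Rgt_not_eq; apply Rmult_lt_0_compat; lra. }
  transitivity (Smod N (S n) * sin (A - g) * sin A).
  { replace (sin A) with (2 * sin (A / 2) * cos (A / 2)); [ring|].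
    rewrite <- sin_2a; f_equal; field. }
  rewrite E4.
  replace (cos g + cos (A - g)) with (2 * cos (A / 2) * cos (A / 2 - g)); [ring|].
  replace (cos (A - g)) with (cos (A / 2 + (A / 2 - g))) by (f_equal; field).
  replace (cos g) with (cos (A / 2 - (A / 2 - g))) by (f_equal; field).
  generalize (A / 2 - g); intros y; rewrite cos_plus, cos_minus; ring.
Qed.

(** For [n = 0] the weights are 1 and the sum is a Dirichlet kernel. *)
Lemma Smod_0 (N : nat) : Smod N 0 * sin (ang N) = cos (ang N / 2).
Proof.
  set (g := ang N). pose proof (ang_spec N) as Hpi; fold g in Hpi.
  set (f := fun l => sin (g * (2 * INR l - INR N)) / 2).
  transitivity (rsum (fun l => f (S l) - f l) N).
  { unfold Smod; rewrite Nat.sub_0_r, Rmult_comm, <- rsum_scal.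
    apply rsum_ext; intros l _; unfold f, offset, weight; simpl rprod.
    rewrite S_INR; fold g; simpl (INR 0).
    replace (2 * g * (INR l - (INR N - 1 - 0) / 2)) with (g * (2 * INR l - INR N + 1)) by field.
    replace (g * (2 * (INR l + 1) - INR N)) with (g * (2 * INR l - INR N + 1) + g) by ring.
    replace (g * (2 * INR l - INR N)) with (g * (2 * INR l - INR N + 1) - g) by ring.
    rewrite sin_plus, sin_minus; field. }
  rewrite rsum_telescope; unfold f; simpl (INR 0).
  replace (g * (2 * 0 - INR N)) with (- (g * INR N)) by ring.
  rewrite sin_neg, <- sin_shift.
  replace (g * (2 * INR N - INR N)) with (g * INR N) by ring.
  replace (PI / 2 - g / 2) with (g * INR N) by (rewrite <- Hpi; field).
  field.
Qed.

(** * Phases of the summands *)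

Definition cis (x : R) : C := (cos x, sin x).

Lemma cis_plus (x y : R) : cis (x + y) = Cmult (cis x) (cis y).
Proof. unfold cis, Cmult; simpl; rewrite cos_plus, sin_plus; f_equal; ring. Qed.

Lemma cis_neg (x : R) : cis (- x) = Cconj (cis x).
Proof. unfold cis, Cconj; simpl; rewrite cos_neg, sin_neg; reflexivity. Qed.

Lemma cis_0 : cis 0 = RtoC 1.
Proof. unfold cis; rewrite cos_0, sin_0; reflexivity. Qed.

Lemma Cmod_cis (x : R) : Cmod (cis x) = 1.
Proof.
  unfold Cmod, cis; simpl fst; simpl snd.
  rewrite <- sqrt_1; f_equal.
  pose proof (sin2_cos2 x) as H; unfold Rsqr in H; lra.
Qed.

Lemma cis_period_nat (x : R) (n : nat) : cis (x + 2 * INR n * PI) = cis x.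
Proof. unfold cis; rewrite cos_period, sin_period; reflexivity. Qed.

Lemma cis_period (x : R) (k : Z) : cis (x + 2 * IZR k * PI) = cis x.
Proof.
  destruct (Z_le_dec 0 k) as [Hk|Hk].
  - rewrite <- (Z2Nat.id k), <- INR_IZR_INZ by lia; apply cis_period_nat.
  - rewrite <- (cis_period_nat _ (Z.to_nat (- k))).
    rewrite INR_IZR_INZ, Z2Nat.id, opp_IZR by lia; f_equal; ring.
Qed.

Lemma one_minus_cis (x : R) :
  Cminus 1 (cis x) = Cmult (RtoC (2 * sin (x / 2))) (cis ((x - PI) / 2)).
Proof.
  unfold cis, Cminus, Cplus, Copp, Cmult, RtoC; simpl.
  replace ((x - PI) / 2) with (- (PI / 2 - x / 2)) by field.
  rewrite cos_neg, sin_neg, cos_shift, sin_shift.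
  replace (cos x) with (cos (2 * (x / 2))) by (f_equal; field).
  replace (sin x) with (sin (2 * (x / 2))) by (f_equal; field).
  rewrite cos_2a_sin, sin_2a; f_equal; ring.
Qed.

Lemma cis_minus_opp (x : R) :
  Cminus (cis x) (cis (- x)) = Cmult (RtoC (2 * sin x)) (cis (PI / 2)).
Proof.
  unfold cis, Cminus, Cplus, Copp, Cmult, RtoC; simpl.
  rewrite cos_neg, sin_neg, cos_PI2, sin_PI2; f_equal; ring.
Qed.

Lemma polar_neq_0 (r x : R) : r <> 0 -> Cmult (RtoC r) (cis x) <> RtoC 0.
Proof.
  intros Hr H; apply Hr; apply (f_equal Cmod) in H.
  rewrite Cmod_mult, Cmod_cis, !Cmod_R, Rabs_R0, Rmult_1_r in H.
  destruct (Req_dec r 0); trivial; now apply Rabs_no_R0 in H.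
Qed.

Lemma polar_mult (p q x y : R) :
  Cmult (Cmult (RtoC p) (cis x)) (Cmult (RtoC q) (cis y))
  = Cmult (RtoC (p * q)) (cis (x + y)).
Proof. rewrite cis_plus, RtoC_mult; ring. Qed.

Lemma polar_div (p q x y : R) : q <> 0 ->
  Cdiv (Cmult (RtoC p) (cis x)) (Cmult (RtoC q) (cis y))
  = Cmult (RtoC (p / q)) (cis (x - y)).
Proof.
  intros Hq; pose proof (polar_neq_0 q y Hq) as H.
  replace (Cmult (RtoC p) (cis x)) with
    (Cmult (Cmult (RtoC (p / q)) (cis (x - y))) (Cmult (RtoC q) (cis y))).
  - field. split; intros E; apply H; rewrite E; ring.
  - rewrite polar_mult; f_equal; f_equal; field; trivial.
Qed.

Lemma Csum_ext (f h : nat -> C) (n : nat) :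
  (forall i, (i < n)%nat -> f i = h i) -> Csum f n = Csum h n.
Proof.
  induction n as [|n IH]; intros H; simpl; trivial.
  rewrite IH, (H n); auto with arith.
Qed.

Lemma Csum_scal (z : C) (f : nat -> C) (n : nat) :
  Csum (fun i => Cmult z (f i)) n = Cmult z (Csum f n).
Proof. induction n as [|n IH]; simpl; [ring | rewrite IH; ring]. Qed.

Lemma Csum_polar (r x : nat -> R) (n : nat) :
  Csum (fun i => Cmult (RtoC (r i)) (cis (x i))) n
  = (rsum (fun i => r i * cos (x i)) n, rsum (fun i => r i * sin (x i)) n).
Proof.
  induction n as [|n IH]; simpl; trivial.
  rewrite IH; unfold Cplus, Cmult, RtoC, cis; simpl; f_equal; ring.
Qed.

Lemma Cprod_ext (f h : nat -> C) (n : nat) :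
  (forall i, (i < n)%nat -> f i = h i) -> Cprod f n = Cprod h n.
Proof.
  induction n as [|n IH]; intros H; simpl; trivial.
  rewrite IH, (H n); auto with arith.
Qed.

Lemma Cprod_polar (r x : nat -> R) (n : nat) :
  Cprod (fun i => Cmult (RtoC (r i)) (cis (x i))) n
  = Cmult (RtoC (rprod r n)) (cis (rsum x n)).
Proof.
  induction n as [|n IH]; simpl; [rewrite cis_0; ring|].
  rewrite IH; apply polar_mult.
Qed.

Lemma Cpow_polar (r x : R) (n : nat) :
  Defs.Cpow (Cmult (RtoC r) (cis x)) n = Cmult (RtoC (r ^ n)) (cis (INR n * x)).
Proof.
  induction n as [|n IH]; [simpl; rewrite Rmult_0_l, cis_0; ring|].
  rewrite S_INR; simpl Defs.Cpow; rewrite IH, polar_mult; simpl pow.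
  f_equal; f_equal; ring.
Qed.

Lemma Cconj_mult (u v : C) : Cconj (Cmult u v) = Cmult (Cconj u) (Cconj v).
Proof. unfold Cconj, Cmult; simpl; f_equal; ring. Qed.

Lemma Cconj_plus (u v : C) : Cconj (Cplus u v) = Cplus (Cconj u) (Cconj v).
Proof. unfold Cconj, Cplus; simpl; f_equal; ring. Qed.

Lemma Cconj_minus (u v : C) : Cconj (Cminus u v) = Cminus (Cconj u) (Cconj v).
Proof. unfold Cconj, Cminus, Cplus, Copp; simpl; f_equal; ring. Qed.

Lemma Cconj_div (u v : C) : Cconj (Cdiv u v) = Cdiv (Cconj u) (Cconj v).
Proof.
  unfold Cdiv; rewrite Cconj_mult; f_equal.
  unfold Cconj, Cinv; simpl; unfold Rdiv; f_equal.
  - f_equal; f_equal; ring.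
  - replace (snd v * (snd v * 1)) with (- snd v * (- snd v * 1)) by ring; ring.
Qed.

Lemma Cconj_R (r : R) : Cconj (RtoC r) = RtoC r.
Proof. unfold Cconj, RtoC; simpl; f_equal; ring. Qed.

Lemma Cconj_sum (f : nat -> C) (n : nat) : Cconj (Csum f n) = Csum (fun i => Cconj (f i)) n.
Proof. induction n as [|n IH]; simpl; [apply Cconj_R | rewrite Cconj_plus, IH; trivial]. Qed.

Lemma Cconj_prod (f : nat -> C) (n : nat) : Cconj (Cprod f n) = Cprod (fun i => Cconj (f i)) n.
Proof. induction n as [|n IH]; simpl; [apply Cconj_R | rewrite Cconj_mult, IH; trivial]. Qed.

Lemma texp_opp (th x : R) : texp (- th) x = Cconj (texp th x).
Proof. unfold texp, Cconj; simpl; rewrite <- Ropp_mult_distr_l, cos_neg, sin_neg; trivial. Qed.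

(** Mirror clasps thus contribute opposite phases but equal moduli: phases will see [c - d] and
    moduli [c + d]. *)
Lemma Ctilde_opp (n : nat) (th : R) (N : nat) : Ctilde n (- th) N = Cconj (Ctilde n th N).
Proof.
  unfold Ctilde; rewrite texp_opp, Cconj_mult, Cconj_sum; f_equal.
  apply Csum_ext; intros l _; rewrite texp_opp, Cconj_mult, Cconj_prod; f_equal.
  apply Cprod_ext; intros j _; cbv zeta.
  rewrite !texp_opp, Cconj_div, Cconj_mult, !Cconj_minus, Cconj_R; trivial.
Qed.

Lemma rsum_affine (x y : R) (n : nat) :
  rsum (fun j => x - y * (INR j + 1)) n = INR n * x - y * (INR n * (INR n + 1)) / 2.
Proof.
  induction n as [|n IH]; [simpl; field|].
  rewrite S_INR; simpl rsum; rewrite IH; field.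
Qed.

(* With [t^(N+1/2) = 1] the reflection [l -> N-1-n-l] pairs the summands into
   complex conjugates up to the common phase, so the sum over [l] is a phase
   times the real number [Smod N n]. *)
Lemma Ctilde_polar (N n : nat) : (n < N)%nat ->
  Ctilde n (4 * ang N) N
  = Cmult (RtoC (Smod N n))
      (cis (PI * (INR N - 1) + INR n * (PI / 2) - ang N * (INR n * (INR n + 1)))).
Proof.
  intros Hn. set (g := ang N).
  pose proof (ang_spec N) as Hpi; fold g in Hpi.
  pose proof (pos_INR n); pose proof (lt_INR _ _ Hn).
  unfold Ctilde.
  set (psi := 2 * g * INR n + g * (INR N - 1 - INR n)
              + INR n * (2 * g * INR N - PI / 2) - g * (INR n * (INR n + 1))).
  rewrite (Csum_ext _ (fun l => Cmult (cis psi)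
      (Cmult (RtoC (weight N n l)) (cis (2 * g * offset N n l))))).
  - rewrite Csum_scal, Csum_polar.
    replace (rsum (fun i => weight N n i * sin (2 * g * offset N n i)) (N - n)) with 0.
    + change (rsum (fun i => weight N n i * cos (2 * g * offset N n i)) (N - n), 0)
        with (RtoC (Smod N n)).
      change (texp (4 * g) (INR N * (INR N - 1) / 2)) with (cis (4 * g * (INR N * (INR N - 1) / 2))).
      transitivity (Cmult (RtoC (Smod N n)) (cis (4 * g * (INR N * (INR N - 1) / 2) + psi))).
      * rewrite cis_plus; ring.
      * f_equal; f_equal; unfold psi; rewrite <- Hpi; field.
    + rewrite (rsum_weight_sym N n (fun u => sin (2 * g * u)) (fun _ => 0)).
      * rewrite (rsum_ext _ (fun _ => 0)) by (intros; ring). rewrite rsum_const; ring.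
      * intros u; rewrite Ropp_mult_distr_r_reverse, sin_neg; ring.
  - intros l Hl.
    rewrite (Cprod_ext _ (fun j => Cmult
       (RtoC (2 * sin (2 * g * (INR N - INR l - (INR j + 1)))
              * sin (2 * g * (INR l + (INR j + 1)))
              / sin (2 * g * (INR j + 1))))
       (cis (2 * g * INR N - PI / 2 - 2 * g * (INR j + 1))))).
    + rewrite Cprod_polar, rsum_affine. fold (weight N n l).
      change (texp (4 * g) (- (INR N * (INR l + INR n))))
        with (cis (4 * g * (- (INR N * (INR l + INR n))))).
      (* Since [4gN = 2 PI - 2g], adding [2 PI (l+n)] reduces the phase to [2g(l+n)], whose part in
         [l] is that of [2g * offset]. *)
      rewrite <- (cis_period_nat (4 * g * (- (INR N * (INR l + INR n)))) (l + n)).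
      transitivity (Cmult (RtoC (weight N n l)) (cis (psi + 2 * g * offset N n l)));
        [|rewrite cis_plus; ring].
      transitivity (Cmult (RtoC (weight N n l))
        (cis (4 * g * - (INR N * (INR l + INR n)) + 2 * INR (l + n) * PI
          + (INR n * (2 * g * INR N - PI / 2) - 2 * g * (INR n * (INR n + 1)) / 2))));
        [rewrite (cis_plus (_ + _)); unfold weight, g; ring|].
      f_equal; f_equal; unfold psi, offset; rewrite plus_INR.
      rewrite <- Hpi; field.
    + intros j Hj; cbv zeta.
      assert (Hs : 0 < sin (2 * g * (INR j + 1))).
      { rewrite (Rmult_comm 2 g), Rmult_assoc; apply sin_ang_pos.
        pose proof (le_INR _ _ Hj) as Hj'; rewrite S_INR in Hj'; pose proof (pos_INR j); lra. }
      change (texp (4 * g) (INR N - INR l - (INR j + 1)))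
        with (cis (4 * g * (INR N - INR l - (INR j + 1)))).
      change (texp (4 * g) (INR l + (INR j + 1))) with (cis (4 * g * (INR l + (INR j + 1)))).
      change (texp (4 * g) (INR j + 1)) with (cis (4 * g * (INR j + 1))).
      rewrite !one_minus_cis, polar_mult.
      replace (4 * g * (INR j + 1) / 2) with (2 * g * (INR j + 1)) by field.
      rewrite polar_div by lra.
      replace (4 * g * (INR N - INR l - (INR j + 1)) / 2)
        with (2 * g * (INR N - INR l - (INR j + 1))) by field.
      replace (4 * g * (INR l + (INR j + 1)) / 2)
        with (2 * g * (INR l + (INR j + 1))) by field.
      f_equal; [apply (f_equal RtoC); field; apply Rgt_not_eq, Hs | apply (f_equal cis); field].
Qed.

Definition amp (r N n : nat) : R := sin (ang N * (2 * INR n + 1)) * Smod N n ^ r.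

Definition centered (N n : nat) : R := INR n + 1/2 - (INR N + 1/2) / 2.

(* The phases of the factors of [JW] add up to a quadratic form centred at
   [N/2 - 1/4]: the linear term is a multiple of [2 PI]. *)
Lemma Cmod_JW (a : Z) (c d N : nat) : (1 <= N)%nat ->
  Cmod (JW a c d N (2 * PI / (INR N + 1/2))) * sin (2 * ang N)
  = Cmod (Csum (fun n => Cmult (RtoC (amp (c + d) N n))
      (cis (ang N * IZR (4 * a - (Z.of_nat c - Z.of_nat d)) * centered N n ^ 2))) N).
Proof.
  intros HN. set (g := ang N).
  pose proof (ang_spec N) as Hpi; fold g in Hpi.
  assert (HN1 : 1 <= INR N) by (replace 1 with (INR 1) by reflexivity; apply le_INR; lia).
  assert (Hs : 0 < sin (2 * g)) by (rewrite Rmult_comm; apply sin_ang_pos; lra).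
  assert (Hth : 2 * PI / (INR N + 1/2) = 4 * g) by (rewrite <- Hpi; field; lra).
  rewrite Hth; unfold JW.
  set (B := (4 * a - (Z.of_nat c - Z.of_nat d))%Z).
  set (m := (INR N + 1/2) / 2).
  assert (HB : IZR B = 4 * IZR a - (INR c - INR d)).
  { unfold B; rewrite !minus_IZR, mult_IZR, <- !INR_IZR_INZ; ring. }
  rewrite (Csum_ext _ (fun n => Cmult (RtoC 2) (Cmult
      (cis (PI / 2 + (INR c - INR d) * (PI * (INR N - 1)) + IZR B * (g * m ^ 2 - g / 4)
            - IZR B * (PI / 2) * (m - 1 / 2)))
      (Cmult (RtoC (amp (c + d) N n)) (cis (g * IZR B * centered N n ^ 2)))))).
  - rewrite !Csum_scal, !Cmod_mult, Cmod_cis, Rmult_1_l.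
    change (texp (4 * g) (1 / 2)) with (cis (4 * g * (1 / 2))).
    change (texp (4 * g) (- (1 / 2))) with (cis (4 * g * - (1 / 2))).
    rewrite Ropp_mult_distr_r_reverse, cis_minus_opp.
    replace (4 * g * (1 / 2)) with (2 * g) by field.
    rewrite Cmod_inv by (apply polar_neq_0; lra).
    rewrite Cmod_mult, Cmod_cis, !Cmod_R, !Rabs_pos_eq by lra.
    field; lra.
  - intros n Hn.
    pose proof (Ctilde_polar N n Hn) as HC; fold g in HC; rewrite Ctilde_opp, HC.
    rewrite Cconj_mult, Cconj_R, <- cis_neg, !Cpow_polar.
    change (texp (4 * g) (INR N * (2 * INR n + 1) / 2)) with (cis (4 * g * (INR N * (2 * INR n + 1) / 2))).
    change (texp (4 * g) (- (INR N * (2 * INR n + 1) / 2))) with (cis (4 * g * - (INR N * (2 * INR n + 1) / 2))).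
    change (texp (4 * g) (IZR a * INR n * (INR n + 1))) with (cis (4 * g * (IZR a * INR n * (INR n + 1)))).
    rewrite Ropp_mult_distr_r_reverse, cis_minus_opp.
    (* [2gN = PI - g], and [2n+1] is odd. *)
    replace (sin (4 * g * (INR N * (2 * INR n + 1) / 2))) with (sin (g * (2 * INR n + 1))).
    2: { rewrite <- (sin_PI_x (g * (2 * INR n + 1))), <- (sin_period _ n).
         f_equal; rewrite <- Hpi; field. }
    (* With [c - d = 4a - B] the linear phase [(c-d) n PI/2] splits into [2 PI a n], absorbed here,
       and [-B n PI/2], which completes the square because [PI = 4gm]. *)
    rewrite <- (cis_period (g * IZR B * centered N n ^ 2) (a * Z.of_nat n)).
    rewrite mult_IZR, <- INR_IZR_INZ. fold g.
    set (phi := PI * (INR N - 1) + INR n * (PI / 2) - g * (INR n * (INR n + 1))).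
    transitivity (Cmult (RtoC (2 * sin (g * (2 * INR n + 1)) * (Smod N n ^ c * Smod N n ^ d)))
      (cis (PI / 2 + 4 * g * (IZR a * INR n * (INR n + 1)) + INR c * phi + INR d * - phi))).
    + rewrite !cis_plus, !RtoC_mult; ring.
    + unfold amp; rewrite pow_add; fold g.
      rewrite !RtoC_mult.
      transitivity (Cmult (RtoC (2 * (sin (g * (2 * INR n + 1)) * (Smod N n ^ c * Smod N n ^ d))))
       (cis (PI / 2 + (INR c - INR d) * (PI * (INR N - 1)) + IZR B * (g * m ^ 2 - g / 4)
            - IZR B * (PI / 2) * (m - 1 / 2) + (g * IZR B * centered N n ^ 2 + 2 * (IZR a * INR n) * PI))));
      [|rewrite (cis_plus (_ - _)), !RtoC_mult; ring].
      rewrite !RtoC_mult; f_equal; [ring|].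
      f_equal. unfold phi, centered; rewrite HB; fold m.
      replace PI with (4 * g * m) by (rewrite <- Hpi; unfold m; field).
      field.
Qed.

(** * Fresnel sums with decreasing weights *)

Lemma sin_ge_half (x : R) : 0 <= x <= 1 -> x / 2 <= sin x.
Proof.
  intros [H0 H1]. destruct (Rle_lt_or_eq_dec 0 x H0) as [Hx|<-]; [|rewrite sin_0; lra].
  destruct (MVT_cor2 sin cos 0 x Hx) as [c [E Hc]];
    [intros; apply derivable_pt_lim_sin|].
  pose proof PI2_3_2; pose proof PI_RGT_0.
  assert (1/2 <= cos c).
  { rewrite <- cos_PI3; apply cos_decr_1; lra. }
  rewrite sin_0 in E; nra.
Qed.

Lemma PI_bounds : 3 < PI <= 4.
Proof. pose proof PI2_3_2; pose proof PI_4; lra. Qed.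

(** For [x = b/4] the angles [x] and [5x] belong to the two innermost values [k = 1/4, 5/4]. The
    bound follows from [sin(3x) = 3s - 4s^3] with [s = sin x <= 1/2]. *)
Lemma sin_five_quarters (x : R) : 0 < x -> 5 * x <= PI / 2 ->
  0 < sin x /\ 2 * sin x <= sin (5 * x).
Proof.
  intros H0 H5; pose proof PI_bounds.
  assert (Hs : 0 < sin x) by (apply sin_gt_0; lra).
  assert (Hs2 : sin x <= 1/2).
  { rewrite <- sin_PI6; apply sin_incr_1; lra. }
  split; trivial.
  apply Rle_trans with (sin (3 * x)); [|apply sin_incr_1; lra].
  replace (3 * x) with (2 * x + x) by ring.
  rewrite sin_plus, sin_2a, cos_2a_sin.
  pose proof (sin2_cos2 x) as H2; unfold Rsqr in H2.
  replace (2 * sin x * cos x * cos x) with (2 * sin x * (1 - sin x * sin x)) by (rewrite <- H2; ring).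
  assert (0 <= sin x * (1/4 - sin x * sin x)) by (apply Rmult_le_pos; nra).
  nra.
Qed.

(** With [k = x0 + i], the angles at [i] and [i+1] are [(b k^2 + 3b/16) -/+ bk]; subtracting [b/16]
    makes the angle 0 at [i = 0] when [x0] is [1/4] or [3/4]. *)
Definition fresnel_angle (x0 b : R) (i : nat) : R := b * (x0 + INR i - 1/2) ^ 2 - b / 16.

Definition fresnel_coeff (w : nat -> R) (x0 b : R) (i : nat) : R :=
  w i / (2 * sin (b * (x0 + INR i))).

(* [2 sin(b k) sin(b k^2 + 3b/16)] is the difference of [cos fresnel_angle] at [k] and
   [k+1]; summation by parts then leaves only nonnegative terms, because
   [w / (2 sin(b k))] decreases and [1 - cos] vanishes at the angle of index 0. *)
Lemma fresnel_partial_sum (w : nat -> R) (x0 b : R) (M : nat) :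
  (x0 - 1/2) ^ 2 = 1/16 -> 0 < x0 -> 0 < b -> b * (x0 + INR (S M)) <= PI / 2 ->
  (forall i, (i <= S M)%nat -> 0 <= w i) ->
  (forall i, (i <= M)%nat -> w (S i) <= w i) ->
  (fresnel_coeff w x0 b 0 - fresnel_coeff w x0 b 1) * (1 - cos (fresnel_angle x0 b 1))
    <= rsum (fun i => w i * sin (b * (x0 + INR i) ^ 2 + 3 * b / 16)) (S (S M)).
Proof.
  intros Hx Hx0 Hb HM Hw Hd. pose proof PI_bounds.
  set (v := fresnel_coeff w x0 b). set (th := fresnel_angle x0 b).
  assert (Hbi : forall i, (i <= S M)%nat -> 0 < b * (x0 + INR i) <= PI / 2).
  { intros i Hi. apply le_INR in Hi. pose proof (pos_INR i). split; nra. }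
  assert (Hs : forall i, (i <= S M)%nat -> 0 < sin (b * (x0 + INR i))).
  { intros i Hi; apply Hbi in Hi; apply sin_gt_0; lra. }
  assert (Hv : forall i, (i <= S M)%nat -> 0 <= v i).
  { intros i Hi; unfold v, fresnel_coeff; apply Rmult_le_pos; [auto|].
    apply Rlt_le, Rinv_0_lt_compat; specialize (Hs i Hi); lra. }
  assert (Hvd : forall i, (i <= M)%nat -> v (S i) <= v i).
  { intros i Hi; unfold v, fresnel_coeff, Rdiv.
    assert (Hi1 : (i <= S M)%nat) by lia. assert (Hi2 : (S i <= S M)%nat) by lia.
    pose proof (Hs _ Hi1); pose proof (Hs _ Hi2); pose proof (Hw _ Hi2).
    apply Rmult_le_compat; auto.
    - apply Rlt_le, Rinv_0_lt_compat; lra.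
    - apply Rinv_le_contravar; [lra|].
      apply Rmult_le_compat_l; [lra|].
      apply Hbi in Hi1; apply Hbi in Hi2.
      apply sin_incr_1; try lra.
      apply Rmult_le_compat_l; [lra|]; rewrite S_INR; lra. }
  assert (Ht : forall i, (i <= S M)%nat ->
     w i * sin (b * (x0 + INR i) ^ 2 + 3 * b / 16) = v i * (cos (th i) - cos (th (S i)))).
  { intros i Hi; specialize (Hs i Hi).
    set (y := b * (x0 + INR i)) in *.
    replace (th i) with ((b * (x0 + INR i) ^ 2 + 3 * b / 16) - y)
      by (unfold th, fresnel_angle, y; field).
    replace (th (S i)) with ((b * (x0 + INR i) ^ 2 + 3 * b / 16) + y)
      by (unfold th, fresnel_angle, y; rewrite S_INR; field).
    generalize (b * (x0 + INR i) ^ 2 + 3 * b / 16); intros z.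
    rewrite cos_minus, cos_plus; unfold v, fresnel_coeff; fold y; field; lra. }
  assert (H0 : cos (th 0%nat) = 1).
  { rewrite <- cos_0; f_equal; unfold th, fresnel_angle; simpl INR.
    replace (x0 + 0 - 1/2) with (x0 - 1/2) by ring. rewrite Hx; field. }
  (* Carrying the boundary term makes the induction close: lowering its coefficient from [v (S m)]
     to [v (S (S m))] only decreases it, and the next summand then merges with it. *)
  assert (Hind : forall m, (m <= M)%nat ->
     (v 0%nat - v 1%nat) * (1 - cos (th 1%nat)) + v (S m) * (1 - cos (th (S (S m))))
     <= rsum (fun i => w i * sin (b * (x0 + INR i) ^ 2 + 3 * b / 16)) (S (S m))).
  { induction m as [|m IH]; intros Hm.
    - cbn [rsum]; rewrite !Ht by lia; rewrite H0; lra.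
    - change (rsum (fun i => w i * sin (b * (x0 + INR i) ^ 2 + 3 * b / 16)) (S (S (S m))))
        with (rsum (fun i => w i * sin (b * (x0 + INR i) ^ 2 + 3 * b / 16)) (S (S m))
              + w (S (S m)) * sin (b * (x0 + INR (S (S m))) ^ 2 + 3 * b / 16)).
      assert (Hm' : (m <= M)%nat) by lia. specialize (IH Hm').
      rewrite Ht by lia.
      assert (Hm2 : (S m <= M)%nat) by lia. pose proof (Hvd _ Hm2).
      pose proof (COS_bound (th (S (S m)))). nra. }
  specialize (Hind M (le_n M)).
  pose proof (Hv (S M) (le_n _)). pose proof (COS_bound (th (S (S M)))). nra.
Qed.

(** Serves the half starting at [3/4], where the sign suffices. *)
Lemma fresnel_partial_sum_nonneg (w : nat -> R) (x0 b : R) (M : nat) :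
  (x0 - 1/2) ^ 2 = 1/16 -> 0 < x0 -> 0 < b -> b * (x0 + INR (S M)) <= PI / 2 ->
  (forall i, (i <= S M)%nat -> 0 <= w i) ->
  (forall i, (i <= M)%nat -> w (S i) <= w i) ->
  0 <= rsum (fun i => w i * sin (b * (x0 + INR i) ^ 2 + 3 * b / 16)) (S (S M)).
Proof.
  intros Hx Hx0 Hb HM Hw Hd. pose proof PI_bounds.
  eapply Rle_trans; [|now apply fresnel_partial_sum].
  apply Rmult_le_pos; [|pose proof (COS_bound (fresnel_angle x0 b 1)); lra].
  apply Rge_le, Rge_minus, Rle_ge. unfold fresnel_coeff, Rdiv.
  rewrite S_INR in HM; pose proof (pos_INR M); simpl INR.
  assert (0 < b * x0) by nra. assert (b * (x0 + 1) <= PI / 2) by nra.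
  assert (0 < sin (b * (x0 + 0))) by (apply sin_gt_0; nra).
  apply Rmult_le_compat.
  - apply Hw; lia.
  - apply Rlt_le, Rinv_0_lt_compat.
    assert (0 < sin (b * (x0 + 1))) by (apply sin_gt_0; nra). lra.
  - apply Hd; lia.
  - apply Rinv_le_contravar; [lra|].
    apply Rmult_le_compat_l; [lra|]. apply sin_incr_1; nra.
Qed.

(** The half starting at [1/4] contains the peak and must give a definite amount.
    [sin_five_quarters] makes the second coefficient at most half the first, so the first term of
    the summation by parts is at least [w0/(4s) * 2s^2] with [s = sin(b/4)]. *)
Lemma fresnel_partial_sum_quarter (w : nat -> R) (x0 b : R) (M : nat) :
  x0 = 1/4 -> 0 < b -> b * (x0 + INR (S M)) <= PI / 2 ->
  (forall i, (i <= S M)%nat -> 0 <= w i) ->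
  (forall i, (i <= M)%nat -> w (S i) <= w i) ->
  w 0%nat * (sin (b / 4) / 2)
    <= rsum (fun i => w i * sin (b * (x0 + INR i) ^ 2 + 3 * b / 16)) (S (S M)).
Proof.
  intros Hx Hb HM Hw Hd. pose proof PI_bounds.
  eapply Rle_trans; [|apply fresnel_partial_sum; trivial; rewrite Hx; lra].
  rewrite S_INR in HM; pose proof (pos_INR M).
  assert (Hb4 : 0 < b / 4) by lra.
  assert (Hb5 : 5 * (b / 4) <= PI / 2) by (rewrite Hx in HM; nra).
  destruct (sin_five_quarters _ Hb4 Hb5) as [Hs1 Hs5].
  unfold fresnel_coeff, fresnel_angle; rewrite Hx; simpl INR.
  replace (b * (1/4 + 0)) with (b / 4) by field.
  replace (b * (1/4 + 1)) with (5 * (b / 4)) by field.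
  replace (b * (1 / 4 + 1 - 1 / 2) ^ 2 - b / 16) with (2 * (b / 4)) by field.
  rewrite cos_2a_sin.
  set (s1 := sin (b / 4)) in *. set (s5 := sin (5 * (b / 4))) in *.
  assert (Hw1 : 0 <= w 1%nat <= w 0%nat) by (split; [apply Hw | apply Hd]; lia).
  assert (Hw1' : w 1%nat / (2 * s5) <= w 0%nat / (4 * s1)).
  { apply Rmult_le_compat; try lra.
    - apply Rlt_le, Rinv_0_lt_compat; lra.
    - apply Rinv_le_contravar; lra. }
  apply Rle_trans with ((w 0%nat / (2 * s1) - w 0%nat / (4 * s1)) * (1 - (1 - 2 * s1 * s1))).
  - apply Req_le; field; lra.
  - apply Rmult_le_compat_r; nra.
Qed.

(** The weights decay geometrically between [h] and [2h], so every later one is at most [q^h w0]; at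
    most [m] of them are discarded. *)
Lemma fresnel_tail (w : nat -> R) (x0 b q : R) (h m : nat) :
  (2 * h + 2 <= m)%nat -> 0 <= q ->
  (forall i, (i < m)%nat -> 0 <= w i) ->
  (forall i, (S i < m)%nat -> w (S i) <= w i) ->
  (forall i, (h <= i)%nat -> (S i < m)%nat -> w (S i) <= q * w i) ->
  rsum (fun i => w i * sin (b * (x0 + INR i) ^ 2 + 3 * b / 16)) (2 * h + 2) - INR m * (q ^ h * w 0%nat)
  <= rsum (fun i => w i * sin (b * (x0 + INR i) ^ 2 + 3 * b / 16)) m.
Proof.
  intros Hm Hq Hw Hd Hdq.
  assert (H1 : forall i, (i < m)%nat -> w i <= w 0%nat).
  { induction i as [|i IH]; intros Hi; [lra|].
    eapply Rle_trans; [apply Hd; lia | apply IH; lia]. }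
  assert (H2 : forall i, (h + i < m)%nat -> w (h + i)%nat <= q ^ i * w 0%nat).
  { induction i as [|i IH]; intros Hi.
    - rewrite Nat.add_0_r; simpl pow; rewrite Rmult_1_l; apply H1; lia.
    - rewrite Nat.add_succ_r. eapply Rle_trans; [apply Hdq; lia|].
      simpl pow; rewrite Rmult_assoc; apply Rmult_le_compat_l; trivial; apply IH; lia. }
  assert (H3 : forall i, (2 * h + i < m)%nat -> w (2 * h + i)%nat <= q ^ h * w 0%nat).
  { induction i as [|i IH]; intros Hi.
    - replace (2 * h + 0)%nat with (h + h)%nat by lia; apply H2; lia.
    - rewrite Nat.add_succ_r. eapply Rle_trans; [apply Hd; lia | apply IH; lia]. }
  replace m with ((2 * h + 2) + (m - (2 * h + 2)))%nat at 2 by lia.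
  rewrite (rsum_add _ (2 * h + 2) (m - (2 * h + 2))).
  assert (Hq0 : 0 <= q ^ h * w 0%nat).
  { apply Rmult_le_pos; [now apply pow_le | apply Hw; lia]. }
  assert (rsum (fun _ => - (q ^ h * w 0%nat)) (m - (2 * h + 2)) <=
    rsum (fun i => w (2 * h + 2 + i)%nat * sin (b * (x0 + INR (2 * h + 2 + i)) ^ 2 + 3 * b / 16)) (m - (2 * h + 2))).
  { apply rsum_le; intros i Hi.
    pose proof (SIN_bound (b * (x0 + INR (2 * h + 2 + i)) ^ 2 + 3 * b / 16)).
    assert (0 <= w (2 * h + 2 + i)%nat <= q ^ h * w 0%nat).
    { split; [apply Hw; lia|]. replace (2 * h + 2 + i)%nat with (2 * h + (2 + i))%nat by lia.
      apply H3; lia. }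
    nra. }
  rewrite rsum_const in H.
  assert (INR (m - (2 * h + 2)) <= INR m) by (apply le_INR; lia).
  nra.
Qed.

(** Both parts are indexed outwards from the cut, so that weights peaked there decrease along
    each. *)
Lemma rsum_split (f : nat -> R) (s N : nat) : (s < N)%nat ->
  rsum f N = rsum (fun i => f (s - i)%nat) (S s) + rsum (fun i => f (S s + i)%nat) (N - S s).
Proof.
  intros H. replace N with (S s + (N - S s))%nat at 1 by lia.
  rewrite rsum_add; f_equal. rewrite rsum_rev; apply rsum_ext; intros i Hi; f_equal; lia.
Qed.

(** * Unimodality and geometric decay of [S_n] *)

Lemma Smod_ratio (N n : nat) : (S n < N)%nat ->
  Smod N (S n) * sin (ang N * (INR n + 3/2)) = sin (PI / 2 - ang N * (INR n + 1/2)) * Smod N n.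
Proof. intros H; rewrite sin_shift; now apply Smod_step. Qed.

Lemma angle_range (N n : nat) : (S n < N)%nat ->
  0 < ang N * (INR n + 1/2) < PI / 2 /\ 0 < ang N * (INR n + 3/2) < PI / 2.
Proof.
  intros H; pose proof (ang_pos N); pose proof (ang_spec N); pose proof (pos_INR n).
  apply le_INR in H; rewrite !S_INR in H. split; split; nra.
Qed.

Lemma Smod_pos (N n : nat) : (n < N)%nat -> 0 < Smod N n.
Proof.
  induction n as [|n IH]; intros Hn.
  - pose proof (Smod_0 N) as E; pose proof (ang_pos N); pose proof (ang_spec N).
    pose proof PI_RGT_0. assert (1 <= INR N) by (apply (le_INR 1); lia).
    assert (0 < sin (ang N)) by (apply sin_gt_0; nra).
    assert (0 < cos (ang N / 2)) by (apply cos_gt_0; nra).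
    apply Rmult_lt_reg_r with (sin (ang N)); lra.
  - pose proof (Smod_ratio N n Hn) as E; destruct (angle_range N n Hn) as [Ha Hb].
    assert (0 < sin (ang N * (INR n + 3/2))) by (apply sin_gt_0; lra).
    apply Rmult_lt_reg_r with (sin (ang N * (INR n + 3/2))); trivial.
    rewrite E, Rmult_0_l; apply Rmult_lt_0_compat; [apply sin_gt_0; lra | apply IH; lia].
Qed.

Lemma le_of_ratio (x y p s q : R) : 0 < s -> 0 <= y ->
  x * s = p * y -> p <= q * s -> x <= q * y.
Proof. intros Hs Hy E H; apply Rmult_le_reg_r with s; trivial; rewrite E; nra. Qed.

(** Bound for the quotient of consecutive [S_n] at angular distance at least [de] from the peak
    angle [PI / 4]. *)
Definition ratio (de : R) : R := sin (PI / 4 - de) / sin (PI / 4 + de).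

Lemma ratio_bounds (de : R) : 0 < de < PI / 4 -> 0 < ratio de < 1.
Proof.
  intros H; pose proof PI_bounds; unfold ratio.
  assert (0 < sin (PI / 4 - de)) by (apply sin_gt_0; lra).
  assert (sin (PI / 4 - de) < sin (PI / 4 + de)) by (apply sin_increasing_1; lra).
  split; [apply Rdiv_lt_0_compat; lra|].
  apply Rmult_lt_reg_r with (sin (PI / 4 + de)); [lra|].
  unfold Rdiv; rewrite Rmult_assoc, Rinv_l; lra.
Qed.


Lemma Smod_step_right (N n : nat) (de : R) : (S n < N)%nat -> 0 < de < PI / 4 ->
  PI / 4 + de <= ang N * (INR n + 1/2) ->
  Smod N (S n) <= ratio de * Smod N n.
Proof.
  intros Hn Hde H; pose proof PI_bounds; destruct (angle_range N n Hn) as [Ha Hb].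
  pose proof (ang_pos N).
  assert (Hs : 0 < sin (PI / 4 + de)) by (apply sin_gt_0; lra).
  assert (Hs' : 0 < sin (PI / 4 - de)) by (apply sin_gt_0; lra).
  assert (Hl : sin (PI / 4 + de) <= sin (ang N * (INR n + 3/2))) by (apply sin_incr_1; nra).
  assert (Hr : sin (PI / 2 - ang N * (INR n + 1/2)) <= sin (PI / 4 - de)) by (apply sin_incr_1; nra).
  eapply le_of_ratio; [ | | exact (Smod_ratio N n Hn) | ].
  - lra.
  - apply Rlt_le, Smod_pos; lia.
  - eapply Rle_trans; [exact Hr|].
    apply Rle_trans with (ratio de * sin (PI / 4 + de)).
    + apply Req_le; unfold ratio; field; lra.
    + apply Rmult_le_compat_l; trivial. apply Rlt_le, ratio_bounds; lra.
Qed.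

Lemma Smod_step_left (N n : nat) (de : R) : (S n < N)%nat -> 0 < de < PI / 4 ->
  ang N * (INR n + 3/2) <= PI / 4 - de ->
  Smod N n <= ratio de * Smod N (S n).
Proof.
  intros Hn Hde H; pose proof PI_bounds; destruct (angle_range N n Hn) as [Ha Hb].
  pose proof (ang_pos N).
  assert (Hs : 0 < sin (PI / 4 + de)) by (apply sin_gt_0; lra).
  assert (Hs' : 0 < sin (PI / 4 - de)) by (apply sin_gt_0; lra).
  assert (Hl : sin (ang N * (INR n + 3/2)) <= sin (PI / 4 - de)) by (apply sin_incr_1; nra).
  assert (Hr : sin (PI / 4 + de) <= sin (PI / 2 - ang N * (INR n + 1/2))) by (apply sin_incr_1; nra).
  eapply le_of_ratio with (s := sin (PI / 2 - ang N * (INR n + 1/2)))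
     (p := sin (ang N * (INR n + 3/2))).
  - lra.
  - apply Rlt_le, Smod_pos; lia.
  - rewrite (Rmult_comm (Smod N n)), <- Smod_ratio by trivial; ring.
  - eapply Rle_trans; [exact Hl|].
    apply Rle_trans with (ratio de * sin (PI / 4 + de)).
    + apply Req_le; unfold ratio; field; lra.
    + apply Rmult_le_compat_l; trivial. apply Rlt_le, ratio_bounds; lra.
Qed.

(** The factor [cos(g(n+1/2)) / sin(g(n+3/2))] is at most 1 exactly when
    [g(2n+2) >= PI/2 = g(N+1/2)], which for integers is the hypothesis. *)
Lemma Smod_decr (N n : nat) : (S n < N)%nat -> (N <= 2 * n + 1)%nat -> Smod N (S n) <= Smod N n.
Proof.
  intros Hn H; pose proof PI_bounds; destruct (angle_range N n Hn) as [Ha Hb].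
  pose proof (ang_pos N); pose proof (ang_spec N).
  apply le_INR in H; rewrite plus_INR, mult_INR in H; simpl INR in H.
  rewrite <- (Rmult_1_l (Smod N n)).
  eapply le_of_ratio; [ | | exact (Smod_ratio N n Hn) | ].
  - apply sin_gt_0; lra.
  - apply Rlt_le, Smod_pos; lia.
  - rewrite Rmult_1_l; apply sin_incr_1; nra.
Qed.

Lemma Smod_incr (N n : nat) : (S n < N)%nat -> (2 * n + 2 <= N)%nat -> Smod N n <= Smod N (S n).
Proof.
  intros Hn H; pose proof PI_bounds; destruct (angle_range N n Hn) as [Ha Hb].
  pose proof (ang_pos N); pose proof (ang_spec N).
  apply le_INR in H; rewrite plus_INR, mult_INR in H; simpl INR in H.
  rewrite <- (Rmult_1_l (Smod N (S n))).
  eapply le_of_ratio with (s := sin (PI / 2 - ang N * (INR n + 1/2)))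
     (p := sin (ang N * (INR n + 3/2))).
  - apply sin_gt_0; lra.
  - apply Rlt_le, Smod_pos; lia.
  - rewrite (Rmult_comm (Smod N n)), <- Smod_ratio by trivial; ring.
  - rewrite Rmult_1_l; apply sin_incr_1; nra.
Qed.

Lemma Smod_max (N n : nat) : (n < N)%nat -> Smod N n <= Smod N (N / 2).
Proof.
  intros Hn. pose proof (Nat.div_mod_eq N 2). pose proof (Nat.mod_upper_bound N 2 ltac:(lia)).
  set (p := (N / 2)%nat) in *.
  destruct (le_lt_dec p n) as [Hp|Hp].
  - assert (Hi : forall i, (p + i < N)%nat -> Smod N (p + i) <= Smod N p).
    { induction i as [|i IH]; intros Hi; [rewrite Nat.add_0_r; lra|].
      rewrite Nat.add_succ_r. eapply Rle_trans; [apply Smod_decr; lia | apply IH; lia]. }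
    replace n with (p + (n - p))%nat by lia; apply Hi; lia.
  - assert (Hi : forall i, (i <= p)%nat -> Smod N (p - i) <= Smod N p).
    { induction i as [|i IH]; intros Hi; [rewrite Nat.sub_0_r; lra|].
      eapply Rle_trans; [apply Smod_incr; lia|].
      replace (S (p - S i)) with (p - i)%nat by lia. apply IH; lia. }
    replace n with (p - (p - n))%nat by lia; apply Hi; lia.
Qed.

(** One of the [r >= 1] factors supplies [q]; for the others [q <= 1] is enough. *)
Lemma mult_pow_le (r : nat) (q x x' s s' : R) : (1 <= r)%nat -> 0 <= q <= 1 ->
  0 <= x' <= x -> 0 <= s -> 0 <= s' <= q * s -> x' * s' ^ r <= q * (x * s ^ r).
Proof.
  intros Hr Hq Hx Hs Hs'.
  assert (H : s' ^ r <= q * s ^ r).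
  { destruct r as [|r]; [lia|]. simpl pow. rewrite <- Rmult_assoc.
    apply Rmult_le_compat; try lra; [apply pow_le; lra|].
    apply pow_incr; nra. }
  assert (0 <= s' ^ r) by (apply pow_le; lra).
  assert (0 <= s ^ r) by (apply pow_le; lra).
  apply Rle_trans with (x * (q * s ^ r)); [|lra].
  apply Rmult_le_compat; lra.
Qed.

(** * Lower bound for the oscillating sum *)

Lemma amp_nonneg (r N n : nat) : (n < N)%nat -> 0 <= amp r N n.
Proof.
  intros Hn; unfold amp; apply Rmult_le_pos.
  - apply Rlt_le, sin_ang_pos; apply lt_INR in Hn; pose proof (pos_INR n); lra.
  - apply pow_le, Rlt_le, Smod_pos; trivial.
Qed.

Lemma amp_le (r N n : nat) : (n < N)%nat -> amp r N n <= Smod N (N / 2) ^ r.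
Proof.
  intros Hn; unfold amp.
  pose proof (SIN_bound (ang N * (2 * INR n + 1))).
  assert (0 <= Smod N n ^ r) by (apply pow_le, Rlt_le, Smod_pos; trivial).
  apply Rle_trans with (Smod N n ^ r); [nra|].
  apply pow_incr; split; [apply Rlt_le, Smod_pos; trivial | now apply Smod_max].
Qed.

Lemma amp_center (r N : nat) : (1 <= N)%nat -> Smod N (N / 2) ^ r / 2 <= amp r N (N / 2).
Proof.
  intros HN; unfold amp.
  pose proof (Nat.div_mod_eq N 2). pose proof (Nat.mod_upper_bound N 2 ltac:(lia)).
  set (p := (N / 2)%nat) in *. pose proof PI_bounds.
  assert (Hp : (p < N)%nat) by lia.
  assert (0 <= Smod N p ^ r) by (apply pow_le, Rlt_le, Smod_pos; trivial).
  assert (Hp1 : INR N <= 2 * INR p + 1).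
  { replace (2 * INR p + 1) with (INR (2 * p + 1)) by (rewrite plus_INR, mult_INR; simpl; ring).
    apply le_INR; lia. }
  assert (Hp3 : 2 * INR p + 1 <= INR N + 1).
  { replace (2 * INR p + 1) with (INR (2 * p + 1)) by (rewrite plus_INR, mult_INR; simpl; ring).
    rewrite <- S_INR; apply le_INR; lia. }
  assert (Hp4 : 1 <= INR N) by (apply (le_INR 1); lia).
  pose proof (ang_pos N); pose proof (ang_spec N).
  assert (1/2 <= sin (ang N * (2 * INR p + 1))); [|nra].
  rewrite <- sin_PI6.
  destruct (Rle_dec (ang N * (2 * INR p + 1)) (PI / 2)).
  - apply sin_incr_1; nra.
  - rewrite <- (sin_PI_x (ang N * (2 * INR p + 1))). apply sin_incr_1; nra.
Qed.

(** [N <= 2n] places [g(2n+1)] beyond [PI / 2], so the sine factor decreases together with [S_n]. *)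
Lemma amp_step_right (r N n : nat) (q : R) : (1 <= r)%nat -> (S n < N)%nat -> (N <= 2 * n)%nat ->
  0 <= q <= 1 -> Smod N (S n) <= q * Smod N n -> amp r N (S n) <= q * amp r N n.
Proof.
  intros Hr Hn H Hq HS; unfold amp.
  pose proof (ang_pos N); pose proof (ang_spec N); pose proof (pos_INR n).
  pose proof (lt_INR _ _ Hn) as Hn'; rewrite S_INR in Hn'.
  apply le_INR in H; rewrite mult_INR in H; simpl INR in H.
  apply mult_pow_le; trivial.
  - split; [apply Rlt_le, sin_ang_pos; rewrite S_INR; lra|].
    rewrite S_INR; apply sin_decr_1; nra.
  - apply Rlt_le, Smod_pos; lia.
  - split; trivial; apply Rlt_le, Smod_pos; lia.
Qed.

Lemma amp_step_left (r N n : nat) (q : R) : (1 <= r)%nat -> (S n < N)%nat -> (2 * n + 3 <= N)%nat ->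
  0 <= q <= 1 -> Smod N n <= q * Smod N (S n) -> amp r N n <= q * amp r N (S n).
Proof.
  intros Hr Hn H Hq HS; unfold amp.
  pose proof (ang_pos N); pose proof (ang_spec N); pose proof (pos_INR n).
  pose proof (lt_INR _ _ Hn) as Hn'; rewrite S_INR in Hn'.
  apply le_INR in H; rewrite plus_INR, mult_INR in H; simpl INR in H.
  apply mult_pow_le; trivial.
  - split; [apply Rlt_le, sin_ang_pos; lra|].
    rewrite S_INR; apply sin_incr_1; nra.
  - apply Rlt_le, Smod_pos; lia.
  - split; trivial; apply Rlt_le, Smod_pos; lia.
Qed.

Definition osc (r N : nat) (b : R) (n : nat) : R :=
  amp r N n * sin (b * centered N n ^ 2 + 3 * b / 16).

Lemma osc_lower (r N h : nat) (b de : R) : (1 <= r)%nat -> (2 * h + 2 <= (N - 1) / 2)%nat ->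
  0 < b -> b * (2 * INR h + 2) <= PI / 2 -> 0 < de < PI / 4 -> de <= ang N * INR h ->
  amp r N (N / 2) * (sin (b / 4) / 2) - 2 * INR N * ratio de ^ h * Smod N (N / 2) ^ r
  <= rsum (osc r N b) N.
Proof.
  intros Hr Hh Hb Hbh Hde Hgh.
  pose proof (ratio_bounds de Hde) as Hq. set (q := ratio de) in *.
  pose proof (Nat.div_mod_eq N 2). pose proof (Nat.mod_upper_bound N 2 ltac:(lia)).
  pose proof (Nat.div_mod_eq (N - 1) 2). pose proof (Nat.mod_upper_bound (N - 1) 2 ltac:(lia)).
  (* With this cut [k] is negative exactly for [n <= s]. The halves start at [-3/4] and [1/4] for
     even [N], at [-1/4] and [3/4] for odd [N]; the peak [p] is always on the quarter side. *)
  set (s := ((N - 1) / 2)%nat) in *. set (p := (N / 2)%nat) in *.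
  pose proof (ang_pos N) as Hg. pose proof (ang_spec N) as Hpi.
  assert (Hs : (s < N)%nat) by lia.
  rewrite (rsum_split _ s N Hs).
  assert (HsN : 2 * INR s + 1 <= INR N <= 2 * INR s + 2).
  { replace (2 * INR s + 1) with (INR (2 * s + 1)) by (rewrite plus_INR, mult_INR; simpl; ring).
    replace (2 * INR s + 2) with (INR (2 * s + 2)) by (rewrite plus_INR, mult_INR; simpl; ring).
    split; apply le_INR; lia. }
  assert (HqS : 0 <= q ^ h) by (apply pow_le; lra).
  set (x0 := centered N (S s)). set (y0 := - centered N s).
  assert (Hx0 : x0 = INR s + 1 + 1/2 - (INR N + 1/2) / 2)
    by (unfold x0, centered; rewrite S_INR; ring).
  assert (Hy0 : y0 = (INR N + 1/2) / 2 - INR s - 1/2) by (unfold y0, centered; ring).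
  set (wL := fun i => amp r N (s - i)). set (wR := fun i => amp r N (S s + i)).
  assert (HwL : forall i, (i < S s)%nat -> 0 <= wL i) by (intros; apply amp_nonneg; lia).
  assert (HwR : forall i, (i < N - S s)%nat -> 0 <= wR i) by (intros; apply amp_nonneg; lia).
  assert (HdL : forall i, (S i < S s)%nat -> wL (S i) <= wL i).
  { intros i Hi; unfold wL; rewrite <- (Rmult_1_l (amp r N (s - i))).
    replace (s - i)%nat with (S (s - S i)) by lia.
    apply amp_step_left; try lia; [lra|].
    rewrite Rmult_1_l; apply Smod_incr; lia. }
  assert (HdR : forall i, (S i < N - S s)%nat -> wR (S i) <= wR i).
  { intros i Hi; unfold wR; rewrite <- (Rmult_1_l (amp r N (S s + i))), Nat.add_succ_r.
    apply amp_step_right; try lia; [lra|].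
    rewrite Rmult_1_l; apply Smod_decr; lia. }
  assert (HqL : forall i, (h <= i)%nat -> (S i < S s)%nat -> wL (S i) <= q * wL i).
  { intros i Hi Hi'; unfold wL.
    replace (s - i)%nat with (S (s - S i)) by lia.
    apply amp_step_left; try lia; [lra|].
    apply Smod_step_left; try lia; trivial.
    rewrite minus_INR, S_INR by lia. apply le_INR in Hi. nra. }
  assert (HqR : forall i, (h <= i)%nat -> (S i < N - S s)%nat -> wR (S i) <= q * wR i).
  { intros i Hi Hi'; unfold wR; rewrite Nat.add_succ_r.
    apply amp_step_right; try lia; [lra|].
    apply Smod_step_right; try lia; trivial.
    rewrite plus_INR, S_INR. apply le_INR in Hi. nra. }
  assert (HmL : (2 * h + 2 <= S s)%nat) by lia.
  assert (HmR : (2 * h + 2 <= N - S s)%nat) by lia.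
  assert (Hq0 : 0 <= q) by lra.
  pose proof (fresnel_tail wL y0 b q h (S s) HmL Hq0 HwL HdL HqL) as TL.
  pose proof (fresnel_tail wR x0 b q h (N - S s) HmR Hq0 HwR HdR HqR) as TR.
  rewrite (rsum_ext (fun i => osc r N b (s - i)) (fun i => wL i * sin (b * (y0 + INR i) ^ 2 + 3 * b / 16))).
  2: { intros i Hi; unfold osc, wL; do 4 f_equal.
       unfold y0, centered; rewrite minus_INR by lia; ring. }
  rewrite (rsum_ext (fun i => osc r N b (S s + i)) (fun i => wR i * sin (b * (x0 + INR i) ^ 2 + 3 * b / 16))).
  2: { intros i Hi; unfold osc, wR; do 5 f_equal.
       unfold x0, centered; rewrite plus_INR; ring. }
  assert (EL : INR (S s) * (q ^ h * wL 0%nat) <= INR N * (q ^ h * Smod N p ^ r)).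
  { apply Rmult_le_compat; [apply pos_INR | apply Rmult_le_pos; [lra | apply HwL; lia] | apply le_INR; lia|].
    apply Rmult_le_compat_l; [lra | apply amp_le; lia]. }
  assert (ER : INR (N - S s) * (q ^ h * wR 0%nat) <= INR N * (q ^ h * Smod N p ^ r)).
  { apply Rmult_le_compat; [apply pos_INR | apply Rmult_le_pos; [lra | apply HwR; lia] | apply le_INR; lia|].
    apply Rmult_le_compat_l; [lra | apply amp_le; lia]. }
  assert (HhS : INR (S (2 * h)) = 2 * INR h + 1) by (rewrite S_INR, mult_INR; simpl; ring).
  replace (2 * h + 2)%nat with (S (S (2 * h))) in TL, TR by lia.
  assert (HxM : x0 <= 1 -> b * (x0 + INR (S (2 * h))) <= PI / 2)
    by (intros Hx; rewrite HhS; nra).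
  assert (HyM : y0 <= 1 -> b * (y0 + INR (S (2 * h))) <= PI / 2)
    by (intros Hx; rewrite HhS; nra).
  assert (HwL' : forall i, (i <= S (2 * h))%nat -> 0 <= wL i) by (intros; apply HwL; lia).
  assert (HwR' : forall i, (i <= S (2 * h))%nat -> 0 <= wR i) by (intros; apply HwR; lia).
  assert (HdL' : forall i, (i <= 2 * h)%nat -> wL (S i) <= wL i) by (intros; apply HdL; lia).
  assert (HdR' : forall i, (i <= 2 * h)%nat -> wR (S i) <= wR i) by (intros; apply HdR; lia).
  assert (Hpar : p = S s \/ p = s) by lia.
  assert (HNp : (p = S s -> N = 2 * s + 2)%nat /\ (p = s -> N = 2 * s + 1)%nat) by lia.
  destruct Hpar as [Hpar|Hpar].
  - assert (HN : INR N = 2 * INR s + 2).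
    { rewrite (proj1 HNp Hpar), plus_INR, mult_INR; simpl; ring. }
    assert (Ex : x0 = 1/4) by (rewrite Hx0, HN; field).
    assert (Ey : y0 = 3/4) by (rewrite Hy0, HN; field).
    pose proof (fresnel_partial_sum_quarter wR x0 b (2 * h) Ex Hb (HxM ltac:(lra)) HwR' HdR') as FR.
    pose proof (fresnel_partial_sum_nonneg wL y0 b (2 * h) ltac:(rewrite Ey; field) ltac:(lra) Hb (HyM ltac:(lra)) HwL' HdL') as FL.
    assert (E0 : wR 0%nat = amp r N p) by (unfold wR; f_equal; lia).
    rewrite E0 in FR, TR. rewrite E0 in ER. lra.
  - assert (HN : INR N = 2 * INR s + 1).
    { rewrite (proj2 HNp Hpar), plus_INR, mult_INR; simpl; ring. }
    assert (Ex : x0 = 3/4) by (rewrite Hx0, HN; field).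
    assert (Ey : y0 = 1/4) by (rewrite Hy0, HN; field).
    pose proof (fresnel_partial_sum_quarter wL y0 b (2 * h) Ey Hb (HyM ltac:(lra)) HwL' HdL') as FL.
    pose proof (fresnel_partial_sum_nonneg wR x0 b (2 * h) ltac:(rewrite Ex; field) ltac:(lra) Hb (HxM ltac:(lra)) HwR' HdR') as FR.
    assert (E0 : wL 0%nat = amp r N p) by (unfold wL; f_equal; lia).
    rewrite E0 in FL, TL. rewrite E0 in EL. lra.
Qed.

(** The tail [2N q^h] must fall below [1/(64N)], that is, [N^2 q^h] must be small with [h]
    proportional to [N]; a bounded [h^3 q^h] gives this with a factor [1/h] to spare. *)
Lemma cube_mult_pow_le (q : R) : 0 < q < 1 ->
  exists C, 0 < C /\ forall h : nat, INR h ^ 3 * q ^ h <= C.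
Proof.
  intros Hq.
  set (eta := - ln q / 3).
  assert (Hln : ln q < 0) by (rewrite <- ln_1; apply ln_increasing; lra).
  assert (Heta : 0 < eta) by (unfold eta; lra).
  exists (/ eta ^ 3); split; [apply Rinv_0_lt_compat, pow_lt; trivial|]. intros h.
  assert (Hqh : q ^ h = / exp (INR h * eta) ^ 3).
  { replace (q ^ h) with (exp (- (INR h * eta + INR h * eta + INR h * eta))).
    - rewrite exp_Ropp, !exp_plus; f_equal; ring.
    - rewrite <- Rpower_pow by lra; unfold Rpower.
      f_equal; unfold eta; field. }
  pose proof (exp_ineq1_le (INR h * eta)) as He.
  pose proof (pos_INR h) as Hh.
  assert (Hx : 0 <= INR h * eta) by nra.
  assert (H3 : (INR h * eta) ^ 3 <= exp (INR h * eta) ^ 3) by (apply pow_incr; lra).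
  assert (0 < exp (INR h * eta) ^ 3) by (apply pow_lt, exp_pos).
  assert (0 < eta ^ 3) by (apply pow_lt; trivial).
  rewrite Hqh. rewrite Rpow_mult_distr in H3.
  apply Rmult_le_reg_r with (exp (INR h * eta) ^ 3 * eta ^ 3); [nra|].
  apply Rle_trans with (INR h ^ 3 * eta ^ 3); [apply Req_le; field; lra|].
  apply Rle_trans with (exp (INR h * eta) ^ 3); [lra|].
  apply Req_le; field; lra.
Qed.

Lemma osc_lower_eventually (r B : nat) : (1 <= r)%nat -> (1 <= B)%nat ->
  exists N0 : nat, forall N, (N0 <= N)%nat ->
  Smod N (N / 2) ^ r / (64 * INR N) <= rsum (osc r N (ang N * INR B)) N.
Proof.
  intros Hr HB. pose proof PI_bounds as Hpi.
  assert (HBR : 1 <= INR B) by (apply (le_INR 1); lia).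
  (* For [h = N/(8B)] the angle [gh] is about [PI/(16B)]; a third of it leaves room for rounding. *)
  set (de := PI / (48 * INR B)).
  assert (Hde : 0 < de < PI / 4).
  { unfold de; split; [apply Rdiv_lt_0_compat; lra|].
    apply Rmult_lt_compat_l; [lra|]. apply Rinv_lt_contravar; lra. }
  destruct (cube_mult_pow_le (ratio de) (ratio_bounds de Hde)) as [C [HC HCh]].
  (* [32768 = 128 * 16^2], from [128 N^2 q^h] and [N <= 16 B h]. *)
  assert (HK : exists K : nat, 32768 * INR B ^ 2 * C <= INR K).
  { destruct (nfloor_ex (32768 * INR B ^ 2 * C)) as [K HK].
    - apply Rmult_le_pos; [|lra]. apply Rmult_le_pos; [lra|apply pow_le; lra].
    - exists (S K); rewrite S_INR; lra. }
  destruct HK as [K HK].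
  exists (8 * B * (K + 2))%nat; intros N HN.
  (* A multiple of [N] small enough that [gB(2h+2) <= PI/2] and that both halves have [2h+2]
     terms. *)
  set (h := (N / (8 * B))%nat).
  assert (HhK : (K + 2 <= h)%nat) by (apply Nat.div_le_lower_bound; lia).
  pose proof (Nat.div_mod_eq N (8 * B)) as E1.
  pose proof (Nat.mod_upper_bound N (8 * B) ltac:(lia)) as E2.
  fold h in E1.
  assert (E3 : (8 * B * h <= N < 8 * B * h + 8 * B)%nat) by lia.
  assert (E3l : 8 * INR B * INR h <= INR N).
  { replace 8 with (INR 8) by (simpl; ring). rewrite <- !mult_INR; apply le_INR; lia. }
  assert (E3r : INR N < 8 * INR B * INR h + 8 * INR B).
  { replace 8 with (INR 8) by (simpl; ring). rewrite <- !mult_INR, <- plus_INR; apply lt_INR; lia. }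
  assert (HhKR : INR K + 2 <= INR h).
  { replace 2 with (INR 2) by (simpl; ring). rewrite <- plus_INR; apply le_INR; lia. }
  pose proof (pos_INR K) as HK0.
  pose proof (ang_pos N) as Hg; pose proof (ang_spec N) as Hgs.
  assert (HN1 : 1 <= INR N) by nra.
  assert (HhN : (2 * h + 2 <= (N - 1) / 2)%nat) by (apply Nat.div_le_lower_bound; nia).
  assert (Hgh : de <= ang N * INR h).
  { unfold de, ang. apply Rmult_le_reg_r with (48 * INR B * (2 * INR N + 1)); [nra|].
    apply Rle_trans with (PI * (2 * INR N + 1)); [apply Req_le; field; lra|].
    apply Rle_trans with (PI * (48 * INR B * INR h)); [|apply Req_le; field; lra].
    apply Rmult_le_compat_l; nra. }
  assert (Hb : 0 < ang N * INR B) by nra.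
  assert (Hbh : ang N * INR B * (2 * INR h + 2) <= PI / 2) by (rewrite <- Hgs; nra).
  eapply Rle_trans; [|apply (osc_lower r N h _ de); trivial].
  pose proof (amp_center r N ltac:(apply INR_le; simpl; lra)) as Hc.
  assert (HS : 0 <= Smod N (N / 2) ^ r).
  { apply pow_le, Rlt_le, Smod_pos. apply Nat.div_lt; lia. }
  assert (Hsin : / (8 * INR N) <= sin (ang N * INR B / 4)).
  { apply Rle_trans with (ang N / 4 / 2).
    - unfold ang. apply Rmult_le_reg_r with (8 * INR N * (2 * INR N + 1)); [nra|].
      apply Rle_trans with (2 * INR N + 1); [apply Req_le; field; lra|].
      apply Rle_trans with (PI * INR N); [|apply Req_le; field; lra]. nra.
    - apply Rle_trans with (sin (ang N / 4)); [apply sin_ge_half; nra|].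
      apply sin_incr_1; nra. }
  assert (Hq : 2 * INR N * ratio de ^ h <= / (64 * INR N)).
  { specialize (HCh h). set (Q := ratio de ^ h) in *.
    assert (HQ : 0 <= Q) by (apply pow_le, Rlt_le, ratio_bounds; trivial).
    assert (HN16 : INR N <= 16 * INR B * INR h) by nra.
    apply Rmult_le_reg_r with (64 * INR N); [lra|].
    rewrite Rinv_l by lra.
    apply Rle_trans with (128 * (16 * INR B * INR h) ^ 2 * Q).
    - replace (2 * INR N * Q * (64 * INR N)) with (128 * INR N ^ 2 * Q) by ring.
      apply Rmult_le_compat_r; trivial. apply Rmult_le_compat_l; [lra|].
      apply pow_incr; lra.
    - apply Rmult_le_reg_r with (INR h); [lra|].
      apply Rle_trans with (32768 * INR B ^ 2 * (INR h ^ 3 * Q)); [apply Req_le; ring|].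
      apply Rle_trans with (32768 * INR B ^ 2 * C); [|lra].
      apply Rmult_le_compat_l; trivial. apply Rmult_le_pos; [lra|apply pow_le; lra]. }
  assert (Hsin0 : 0 < / (8 * INR N)) by (apply Rinv_0_lt_compat; lra).
  (* [1/32] is [1/2] from [amp_center] times [1/16] from the sine; the tail may use up half of it,
     leaving [1/64]. *)
  assert (Hmain : Smod N (N / 2) ^ r * / (32 * INR N) <= amp r N (N / 2) * (sin (ang N * INR B / 4) / 2)).
  { replace (/ (32 * INR N)) with (1/2 * (/ (8 * INR N) / 2)) by (field; lra).
    rewrite <- Rmult_assoc. apply Rmult_le_compat; lra. }
  assert (Htail : 2 * INR N * ratio de ^ h * Smod N (N / 2) ^ r <= / (64 * INR N) * Smod N (N / 2) ^ r)
    by (apply Rmult_le_compat_r; trivial).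
  replace (Smod N (N / 2) ^ r / (64 * INR N)) with
    (Smod N (N / 2) ^ r * / (32 * INR N) - / (64 * INR N) * Smod N (N / 2) ^ r) by (field; lra).
  lra.
Qed.

(** * The Lobachevsky value *)

Definition lsin (x : R) : R := ln (2 * sin x).
Definition lcos (x : R) : R := ln (2 * cos x).
Definition lcot (x : R) : R := ln (cos x / sin x).

Lemma sin_pos_half (x : R) : 0 < x <= PI / 2 -> 0 < sin x.
Proof. intros H; pose proof PI_bounds; apply sin_gt_0; lra. Qed.

Lemma cos_pos_half (x : R) : - (PI / 2) < x < PI / 2 -> 0 < cos x.
Proof. intros H; apply cos_gt_0; lra. Qed.

Lemma ex_RInt_lsin (x y : R) : 0 < x <= PI / 2 -> 0 < y <= PI / 2 -> ex_RInt lsin x y.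
Proof.
  intros Hx Hy; apply (ex_RInt_continuous (V := R_CompleteNormedModule)); intros z Hz.
  apply (ex_derive_continuous (V := R_NormedModule)); unfold lsin; auto_derive.
  assert (0 < sin z); [apply sin_pos_half | lra].
  split; [eapply Rlt_le_trans, Hz | eapply Rle_trans; [apply Hz|]].
  - apply Rmin_glb_lt; lra.
  - apply Rmax_lub; lra.
Qed.

Lemma ex_RInt_lcos (x y : R) :
  - (PI / 2) < x < PI / 2 -> - (PI / 2) < y < PI / 2 -> ex_RInt lcos x y.
Proof.
  intros Hx Hy; apply (ex_RInt_continuous (V := R_CompleteNormedModule)); intros z Hz.
  apply (ex_derive_continuous (V := R_NormedModule)); unfold lcos; auto_derive.
  assert (0 < cos z); [apply cos_pos_half | lra].
  split; [eapply Rlt_le_trans, Hz | eapply Rle_lt_trans; [apply Hz|]].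
  - apply Rmin_glb_lt; lra.
  - apply Rmax_lub_lt; lra.
Qed.

Lemma lcot_minus (x : R) : 0 < x < PI / 2 -> lcot x = lcos x - lsin x.
Proof.
  intros H; assert (0 < sin x) by (apply sin_pos_half; lra).
  assert (0 < cos x) by (apply cos_pos_half; lra).
  unfold lcot, lcos, lsin; rewrite <- ln_div by lra; f_equal; field; lra.
Qed.

Lemma between_bounds (x y z lo hi : R) :
  lo < x < hi -> lo < y < hi -> Rmin x y < z < Rmax x y -> lo < z < hi.
Proof.
  intros Hx Hy Hz; split.
  - eapply Rlt_trans; [|apply Hz]. apply Rmin_glb_lt; lra.
  - eapply Rlt_trans; [apply Hz|]. apply Rmax_lub_lt; lra.
Qed.

Lemma is_RInt_lcot (x y : R) : 0 < x < PI / 2 -> 0 < y < PI / 2 ->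
  is_RInt lcot x y (RInt lcos x y - RInt lsin x y).
Proof.
  intros Hx Hy.
  apply (is_RInt_ext (fun t => minus (lcos t) (lsin t))).
  - intros z Hz; apply eq_sym, lcot_minus. now apply (between_bounds x y).
  - apply (is_RInt_minus lcos lsin x y); apply (RInt_correct (V := R_CompleteNormedModule));
      [apply ex_RInt_lcos | apply ex_RInt_lsin]; lra.
Qed.

(** The substitution [y -> 2y] turns the left side into half the integral of [lsin] from [2x] to
    [PI/2]; its part beyond [PI/4] becomes an integral of [lcos] under [y -> PI/2 - y]. *)
Lemma RInt_lsin_doubling (x : R) : 0 < x <= PI / 4 ->
  RInt lsin x (PI / 4) + RInt lcos x (PI / 4)
  = (RInt lsin (2 * x) (PI / 4) + RInt lcos 0 (PI / 4)) / 2.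
Proof.
  intros Hx; pose proof PI_bounds.
  assert (E1 : RInt lsin (2 * x) (PI / 2) = 2 * (RInt lsin x (PI / 4) + RInt lcos x (PI / 4))).
  { transitivity (RInt lsin (2 * x + 0) (2 * (PI / 4) + 0)); [f_equal; field|].
    rewrite <- (RInt_comp_lin (V := R_CompleteNormedModule)) by (apply ex_RInt_lsin; lra).
    apply is_RInt_unique.
    apply (is_RInt_ext (fun y => scal 2 (plus (lsin y) (lcos y)))).
    - intros z Hz. rewrite Rmin_left, Rmax_right in Hz by lra.
      assert (0 < sin z) by (apply sin_pos_half; lra).
      assert (0 < cos z) by (apply cos_pos_half; lra).
      f_equal. unfold lsin, lcos, plus; simpl; rewrite <- ln_mult by lra.
      f_equal; rewrite Rplus_0_r, sin_2a; ring.
    - apply (is_RInt_scal (V := R_NormedModule)), (is_RInt_plus lsin lcos);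
        apply (RInt_correct (V := R_CompleteNormedModule));
        [apply ex_RInt_lsin; lra | apply ex_RInt_lcos; lra]. }
  assert (E2 : RInt lsin (PI / 4) (PI / 2) = RInt lcos 0 (PI / 4)).
  { rewrite <- opp_RInt_swap by (apply ex_RInt_lsin; lra).
    transitivity (opp (RInt lsin (-1 * 0 + PI / 2) (-1 * (PI / 4) + PI / 2)));
      [f_equal; f_equal; field|].
    rewrite <- (RInt_comp_lin (V := R_CompleteNormedModule)) by (apply ex_RInt_lsin; lra).
    rewrite <- (RInt_opp (V := R_CompleteNormedModule)).
    - apply RInt_ext; intros z Hz. change (- (-1 * lsin (-1 * z + PI / 2)) = lcos z).
      unfold lsin, lcos; rewrite <- (sin_shift z).
      replace (-1 * z + PI / 2) with (PI / 2 - z) by ring.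
      ring.
    - apply (ex_RInt_comp_lin lsin (-1) (PI / 2) 0 (PI / 4)); apply ex_RInt_lsin; lra. }
  assert (E3 : RInt lsin (2 * x) (PI / 4) + RInt lsin (PI / 4) (PI / 2) = RInt lsin (2 * x) (PI / 2)).
  { apply (RInt_Chasles (V := R_CompleteNormedModule)); apply ex_RInt_lsin; lra. }
  rewrite E1, E2 in E3. lra.
Qed.

(** On this range [t <= 2 sin t <= 1], and [-ln t = 2 ln(1/sqrt t) <= 2/sqrt t], which has the
    primitive [4 sqrt t]. *)
Lemma abs_RInt_lsin_le (x y : R) : 0 < x -> x <= y -> y <= 1/2 -> Rabs (RInt lsin x y) <= 4 * sqrt y.
Proof.
  intros Hx Hxy Hy; pose proof PI_bounds.
  assert (Hex : ex_RInt lsin x y) by (apply ex_RInt_lsin; lra).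
  assert (Hb : is_RInt (fun t => - (2 / sqrt t)) x y (minus (- (4 * sqrt y)) (- (4 * sqrt x)))).
  { assert (Hpos : forall t, Rmin x y <= t <= Rmax x y -> 0 < t)
      by (intros t Ht; rewrite Rmin_left in Ht by lra; lra).
    apply (is_RInt_derive (V := R_CompleteNormedModule) (fun t => - (4 * sqrt t))).
    - intros t Ht; apply Hpos in Ht. pose proof (sqrt_lt_R0 _ Ht).
      auto_derive; [trivial | field; lra].
    - intros t Ht; apply Hpos in Ht. pose proof (sqrt_lt_R0 _ Ht).
      apply (ex_derive_continuous (V := R_NormedModule)); auto_derive; lra. }
  assert (Hp : forall t, x < t < y -> - (2 / sqrt t) <= lsin t <= 0).
  { intros t Ht. assert (Hst : 0 < sqrt t) by (apply sqrt_lt_R0; lra).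
    pose proof (sin_ge_half t ltac:(lra)) as Hs1. pose proof (sin_lt_x t ltac:(lra)) as Hs2.
    unfold lsin; split.
    - apply Rle_trans with (ln t); [|apply ln_le; lra].
      assert (E : ln t = - (2 * ln (/ sqrt t))).
      { rewrite ln_Rinv by trivial. rewrite <- (sqrt_sqrt t) at 1 by lra.
        rewrite ln_mult by trivial; ring. }
      rewrite E. apply Ropp_le_contravar. unfold Rdiv; apply Rmult_le_compat_l; [lra|].
      pose proof (Rinv_0_lt_compat _ Hst).
      pose proof (exp_ineq1_le (ln (/ sqrt t))). rewrite exp_ln in H1 by trivial. lra.
    - rewrite <- ln_1. apply ln_le; lra. }
  assert (H1 : RInt (fun t => - (2 / sqrt t)) x y <= RInt lsin x y).
  { apply RInt_le; trivial; [eexists; exact Hb | intros; apply Hp; trivial]. }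
  rewrite (is_RInt_unique _ _ _ _ Hb) in H1. unfold minus, plus, opp in H1; simpl in H1.
  assert (H2 : RInt lsin x y <= RInt (fun _ => 0) x y).
  { apply RInt_le; trivial; [apply ex_RInt_const | intros; apply Hp; trivial]. }
  rewrite RInt_const in H2. unfold scal in H2; simpl in H2; unfold mult in H2; simpl in H2.
  pose proof (sqrt_pos x); pose proof (sqrt_pos y).
  apply Rabs_le; lra.
Qed.

(** The doubling identity determines the limit only once it exists; existence comes from the Cauchy
    criterion. *)
Lemma ex_lim_RInt_lsin :
  exists u, filterlim (fun x => RInt lsin x (PI / 4)) (at_right 0) (locally u).
Proof.
  pose proof PI_bounds.
  apply (filterlim_locally_cauchy (U := R_CompleteSpace)).
  intros eps.
  (* [y < eps^2/17] gives [(4 sqrt y)^2 = 16 y < eps^2]; [1/2] is the range of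
     [abs_RInt_lsin_le]. *)
  set (de := Rmin (1/2) (eps ^ 2 / 17)).
  assert (Hde : 0 < de).
  { apply Rmin_glb_lt; [lra|]. apply Rdiv_lt_0_compat; [apply pow_lt, cond_pos | lra]. }
  assert (Hle : forall x y, 0 < x -> x <= y -> y < de ->
     Rabs (RInt lsin x (PI / 4) - RInt lsin y (PI / 4)) < eps).
  { intros x y Hx Hxy Hy.
    pose proof (Rmin_l (1/2) (eps ^ 2 / 17)); pose proof (Rmin_r (1/2) (eps ^ 2 / 17)).
    fold de in H0, H1.
    assert (E : RInt lsin x y + RInt lsin y (PI / 4) = RInt lsin x (PI / 4)).
    { apply (RInt_Chasles (V := R_CompleteNormedModule)); apply ex_RInt_lsin; lra. }
    assert (E' : RInt lsin x (PI / 4) - RInt lsin y (PI / 4) = RInt lsin x y) by (rewrite <- E; ring).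
    rewrite E'.
    eapply Rle_lt_trans; [apply abs_RInt_lsin_le; lra|].
    apply Rsqr_incrst_0; try (pose proof (sqrt_pos y); pose proof (cond_pos eps); lra).
    unfold Rsqr. replace (4 * sqrt y * (4 * sqrt y)) with (16 * (sqrt y * sqrt y)) by ring.
    rewrite sqrt_sqrt by lra. pose proof (pow_lt eps 2 (cond_pos eps)). simpl pow in *. lra. }
  exists (fun x => 0 < x < de); split.
  - exists (mkposreal de Hde); intros y Hy Hy0.
    split; trivial. apply Rabs_lt_between in Hy. unfold minus, plus, opp in Hy; simpl in Hy. lra.
  - intros x y Hx Hy. change (Rabs (RInt lsin y (PI / 4) - RInt lsin x (PI / 4)) < eps).
    destruct (Rle_dec y x); [apply Hle; lra|].
    rewrite Rabs_minus_sym; apply Hle; lra.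
Qed.

Lemma lim_RInt_lcos :
  filterlim (fun x => RInt lcos x (PI / 4)) (at_right 0) (locally (RInt lcos 0 (PI / 4))).
Proof.
  pose proof PI_bounds.
  apply (filterlim_filter_le_1 (F := locally 0)); [apply filter_le_within|].
  apply (continuous_RInt_2 (V := R_NormedModule) lcos 0 (PI / 4)).
  exists (mkposreal 1 Rlt_0_1); intros z Hz.
  apply Rabs_lt_between in Hz; unfold minus, plus, opp in Hz; simpl in Hz.
  apply (RInt_correct (V := R_CompleteNormedModule)), ex_RInt_lcos; lra.
Qed.

(* [2 sin x * 2 cos x = 2 sin(2x)] makes the two integrals over [0, PI/4]
   satisfy [u + v = (u + v) / 2], hence cancel. *)
Lemma lim_RInt_lsin :
  filterlim (fun x => RInt lsin x (PI / 4)) (at_right 0) (locally (- RInt lcos 0 (PI / 4))).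
Proof.
  pose proof PI_bounds.
  destruct ex_lim_RInt_lsin as [u Hu].
  set (v := RInt lcos 0 (PI / 4)).
  assert (E : u + v = (u + v) / 2).
  { apply (filterlim_locally_unique (V := R_NormedModule) (F := at_right 0)
      (fun x => RInt lsin x (PI / 4) + RInt lcos x (PI / 4))).
    - eapply filterlim_comp_2; [exact Hu | exact lim_RInt_lcos |].
      apply (filterlim_plus (V := R_NormedModule) u v).
    - apply (filterlim_ext_loc (fun x => /2 * (RInt lsin (2 * x) (PI / 4) + v))).
      { exists (mkposreal (PI / 4) ltac:(lra)); intros y Hy Hy0.
        apply Rabs_lt_between in Hy; unfold minus, plus, opp in Hy; simpl in Hy.
        rewrite RInt_lsin_doubling by lra. fold v; field. }
      replace ((u + v) / 2) with (/ 2 * (u + v)) by field.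
      eapply filterlim_comp; [|apply (filterlim_scal_r (V := R_NormedModule) (/ 2) (u + v))].
      eapply filterlim_comp_2; [| apply filterlim_const | apply (filterlim_plus (V := R_NormedModule) u v)].
      apply (filterlim_comp _ _ _ (fun x => 2 * x) (fun x => RInt lsin x (PI / 4)) (at_right 0) (at_right 0)); trivial.
      intros P [e He]. assert (He2 : 0 < e / 2) by (pose proof (cond_pos e); lra).
      exists (mkposreal _ He2); intros y Hy Hy0; apply He; [|lra].
      apply Rabs_lt_between in Hy; unfold minus, plus, opp in Hy; simpl in Hy.
      apply Rabs_lt_between; unfold minus, plus, opp; simpl; lra. }
  replace (- v) with u by lra. exact Hu.
Qed.

Lemma lim_RInt_lcot :
  filterlim (fun x => RInt lcot x (PI / 4)) (at_right 0) (locally (2 * RInt lcos 0 (PI / 4))).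
Proof.
  pose proof PI_bounds.
  apply (filterlim_ext_loc (fun x => RInt lcos x (PI / 4) + - RInt lsin x (PI / 4))).
  { exists (mkposreal (PI / 4) ltac:(lra)); intros y Hy Hy0.
    apply Rabs_lt_between in Hy; unfold minus, plus, opp in Hy; simpl in Hy.
    apply eq_sym, is_RInt_unique, is_RInt_lcot; lra. }
  replace (2 * RInt lcos 0 (PI / 4)) with (RInt lcos 0 (PI / 4) + - - RInt lcos 0 (PI / 4)) by ring.
  eapply filterlim_comp_2; [exact lim_RInt_lcos | |
    apply (filterlim_plus (V := R_NormedModule) (RInt lcos 0 (PI / 4)) (- - RInt lcos 0 (PI / 4)))].
  eapply filterlim_comp; [exact lim_RInt_lsin | apply (filterlim_opp (V := R_NormedModule))].
Qed.

(** [lcos] is regular at 0, so the improper Lobachevsky integral is replaced by an ordinary one. *)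
Lemma v8_eq : v8 = 8 * RInt lcos 0 (PI / 4).
Proof.
  pose proof PI_bounds.
  unfold v8, Lobachevsky; f_equal.
  rewrite <- (Ropp_involutive (RInt lcos 0 (PI / 4))); f_equal.
  apply (is_RInt_gen_unique (V := R_CompleteNormedModule)).
  intros P HP.
  apply lim_RInt_lsin in HP. destruct HP as [e He].
  set (de := mkposreal (Rmin e (PI / 4)) ltac:(apply Rmin_glb_lt; [apply cond_pos | lra])).
  apply (Filter_prod _ _ _ (fun x => 0 < x < de) (fun y => y = PI / 4)).
  - exists de; intros y Hy Hy0; split; trivial.
    apply Rabs_lt_between in Hy; unfold minus, plus, opp in Hy; simpl in Hy |- *; lra.
  - reflexivity.
  - intros x y Hx ->; simpl in Hx |- *.
    pose proof (Rmin_l e (PI / 4)); pose proof (Rmin_r e (PI / 4)).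
    exists (RInt lsin x (PI / 4)); split.
    + apply (is_RInt_ext lsin).
      * intros z Hz. rewrite Rmin_left, Rmax_right in Hz by lra.
        assert (0 < sin z) by (apply sin_pos_half; lra).
        unfold lsin; rewrite Rabs_pos_eq; lra.
      * apply (RInt_correct (V := R_CompleteNormedModule)), ex_RInt_lsin; lra.
    + apply He; [|lra].
      apply Rabs_lt_between; unfold minus, plus, opp; simpl; lra.
Qed.

(** * Asymptotics of the invariant *)

Lemma Cmod_Csum_le (f : nat -> C) (n : nat) : Cmod (Csum f n) <= rsum (fun i => Cmod (f i)) n.
Proof.
  induction n as [|n IH]; simpl; [rewrite Cmod_0; lra|].
  eapply Rle_trans; [apply Cmod_triangle | lra].
Qed.

(** A rotation by [de] preserves the modulus, which dominates the imaginary part; [de] is free to be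
    chosen. *)
Lemma Cmod_Csum_polar_ge (r x : nat -> R) (de : R) (n : nat) :
  Rabs (rsum (fun i => r i * sin (x i + de)) n)
  <= Cmod (Csum (fun i => Cmult (RtoC (r i)) (cis (x i))) n).
Proof.
  rewrite <- (Rmult_1_l (Cmod _)), <- (Cmod_cis de), <- Cmod_mult, <- Csum_scal.
  rewrite (Csum_ext _ (fun i => Cmult (RtoC (r i)) (cis (x i + de))))
    by (intros; rewrite cis_plus; ring).
  rewrite Csum_polar.
  eapply Rle_trans; [|apply Rmax_Cmod]. apply Rmax_r.
Qed.

Lemma Cmod_JW_upper (a : Z) (c d N : nat) : (1 <= N)%nat ->
  Cmod (JW a c d N (2 * PI / (INR N + 1/2))) * sin (2 * ang N)
  <= INR N * Smod N (N / 2) ^ (c + d).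
Proof.
  intros HN; rewrite Cmod_JW by trivial.
  eapply Rle_trans; [apply Cmod_Csum_le|].
  rewrite <- rsum_const; apply rsum_le; intros n Hn.
  rewrite Cmod_mult, Cmod_cis, Cmod_R, Rmult_1_r, Rabs_pos_eq by (now apply amp_nonneg).
  now apply amp_le.
Qed.

Lemma Cmod_JW_lower (a : Z) (c d : nat) : (1 <= c + d)%nat ->
  exists N0 : nat, forall N, (N0 <= N)%nat -> (1 <= N)%nat ->
  Smod N (N / 2) ^ (c + d) / (64 * INR N)
  <= Cmod (JW a c d N (2 * PI / (INR N + 1/2))) * sin (2 * ang N).
Proof.
  intros Hr.
  set (B := (4 * a - (Z.of_nat c - Z.of_nat d))%Z).
  destruct (Z.eq_dec B 0) as [HB|HB].
  - exists 1%nat; intros N _ HN. rewrite Cmod_JW by trivial. fold B; rewrite HB.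
    (* For [B = 0] no phase is left: a quarter turn makes all sines 1, and the nonnegative sum
       dominates its central term. *)
    eapply Rle_trans; [|apply (Cmod_Csum_polar_ge (amp (c + d) N) _ (PI / 2))].
    eapply Rle_trans; [|apply Rle_abs].
    rewrite (rsum_ext _ (amp (c + d) N)).
    2: { intros n Hn; rewrite Rmult_0_r, Rmult_0_l, Rplus_0_l, sin_PI2; ring. }
    assert (Hp : (N / 2 < N)%nat) by (apply Nat.div_lt; lia).
    rewrite (rsum_split _ _ _ Hp), rsum_shift, Nat.sub_0_r.
    assert (Hnn : forall (f : nat -> R) m, (forall i, (i < m)%nat -> 0 <= f i) -> 0 <= rsum f m).
    { intros f m Hf; rewrite <- (Rmult_0_r (INR m)), <- rsum_const; now apply rsum_le. }
    pose proof (Hnn (fun i => amp (c + d) N (N / 2 - S i)) (N / 2)%nat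
      ltac:(intros; apply amp_nonneg; lia)).
    pose proof (Hnn (fun i => amp (c + d) N (S (N / 2) + i)) (N - S (N / 2))%nat
      ltac:(intros; apply amp_nonneg; lia)).
    pose proof (amp_center (c + d) N HN).
    assert (HS : 0 <= Smod N (N / 2) ^ (c + d)) by (now apply pow_le, Rlt_le, Smod_pos).
    assert (HN1 : 1 <= INR N) by (apply (le_INR 1); lia).
    apply Rle_trans with (Smod N (N / 2) ^ (c + d) / 2); [|lra].
    apply Rmult_le_compat_l; trivial. apply Rinv_le_contravar; lra.
  - destruct (osc_lower_eventually (c + d) (Z.abs_nat B)) as [N0 HN0]; [lia | lia|].
    exists N0; intros N HN HN1. rewrite Cmod_JW by trivial. fold B.
    eapply Rle_trans; [now apply HN0|].
    assert (HBa : INR (Z.abs_nat B) = IZR (Z.abs B)) by (rewrite INR_IZR_INZ, Zabs2Nat.id_abs; trivial).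
    rewrite HBa. destruct (Z_lt_ge_dec 0 B) as [Hs|Hs].
    + rewrite Z.abs_eq by lia.
      eapply Rle_trans; [|apply (Cmod_Csum_polar_ge (amp (c + d) N) _ (3 * (ang N * IZR B) / 16))].
      apply Rle_abs.
    (* For negative [B] the rotated phases are those of [-B] with the opposite sign, so only the
       sign of the sine sum changes. *)
    + rewrite Z.abs_neq, opp_IZR by lia.
      eapply Rle_trans; [|apply (Cmod_Csum_polar_ge (amp (c + d) N) _ (3 * (ang N * IZR B) / 16))].
      rewrite <- Rabs_Ropp. eapply Rle_trans; [|apply Rle_abs].
      apply Req_le.
      match goal with |- _ = - ?T => replace (- T) with (-1 * T) by ring end.
      rewrite <- rsum_scal.
      apply rsum_ext; intros n _; unfold osc.
      replace (ang N * - IZR B * centered N n ^ 2 + 3 * (ang N * - IZR B) / 16) with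
       (- (ang N * IZR B * centered N n ^ 2 + 3 * (ang N * IZR B) / 16)) by field.
      rewrite sin_neg; ring.
Qed.

(** * Logarithmic bounds by Riemann sums of log cot *)

Definition lcot_int (x : R) : R := RInt lcot x (PI / 4).

Lemma lcot_decr (x y : R) : 0 < x -> x <= y -> y < PI / 2 -> lcot y <= lcot x.
Proof.
  intros Hx Hxy Hy.
  assert (0 < sin x) by (apply sin_pos_half; lra).
  assert (0 < cos y) by (apply cos_pos_half; lra).
  unfold lcot; apply ln_le.
  - apply Rdiv_lt_0_compat; trivial; apply sin_pos_half; lra.
  - apply Rmult_le_compat; try lra.
    + apply Rlt_le, Rinv_0_lt_compat, sin_pos_half; lra.
    + apply cos_decr_1; lra.
    + apply Rinv_le_contravar; trivial; apply sin_incr_1; lra.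
Qed.

Lemma ex_RInt_lcot (x y : R) : 0 < x < PI / 2 -> 0 < y < PI / 2 -> ex_RInt lcot x y.
Proof. intros Hx Hy; eexists; now apply is_RInt_lcot. Qed.

Lemma lcot_int_step (x e : R) : 0 < x -> 0 < e -> x + e < PI / 2 ->
  e * lcot (x + e) <= lcot_int x - lcot_int (x + e) <= e * lcot x.
Proof.
  intros Hx He Hxe. pose proof PI_bounds.
  assert (E : RInt lcot x (x + e) + lcot_int (x + e) = lcot_int x).
  { apply (RInt_Chasles (V := R_CompleteNormedModule)); apply ex_RInt_lcot; lra. }
  assert (Hex : ex_RInt lcot x (x + e)) by (apply ex_RInt_lcot; lra).
  assert (Hc : forall k : R, RInt (fun _ => k) x (x + e) = e * k).
  { intros k; rewrite RInt_const. change ((x + e - x) * k = e * k). ring. }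
  rewrite <- E, <- !Hc. split.
  - assert (RInt (fun _ => lcot (x + e)) x (x + e) <= RInt lcot x (x + e)).
    { apply RInt_le; trivial; [lra | apply ex_RInt_const|].
      intros; apply lcot_decr; lra. }
    lra.
  - assert (RInt lcot x (x + e) <= RInt (fun _ => lcot x) x (x + e)).
    { apply RInt_le; trivial; [lra | apply ex_RInt_const|].
      intros; apply lcot_decr; lra. }
    lra.
Qed.

(** The quotient is [cos x / sin y] with two neighbouring angles [x <= y]; equating them either way
    gives a cotangent on each side. *)
Lemma ln_Smod_step (N n : nat) : (S n < N)%nat ->
  lcot (ang N * (INR n + 3/2)) <= ln (Smod N (S n)) - ln (Smod N n)
  <= lcot (ang N * (INR n + 1/2)).
Proof.
  intros Hn. destruct (angle_range N n Hn) as [H1 H2]. pose proof (ang_pos N).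
  pose proof (Smod_step N n Hn) as E.
  assert (HS : 0 < Smod N n) by (apply Smod_pos; lia).
  assert (HS' : 0 < Smod N (S n)) by (apply Smod_pos; lia).
  set (x := ang N * (INR n + 1/2)) in *. set (y := ang N * (INR n + 3/2)) in *.
  assert (Hxy : x <= y) by (unfold x, y; nra).
  assert (0 < cos x) by (apply cos_pos_half; lra). assert (0 < cos y) by (apply cos_pos_half; lra).
  assert (0 < sin x) by (apply sin_pos_half; lra). assert (0 < sin y) by (apply sin_pos_half; lra).
  assert (Hcos : cos y <= cos x) by (apply cos_decr_1; lra).
  assert (Hsin : sin x <= sin y) by (apply sin_incr_1; lra).
  assert (E' : Smod N (S n) / Smod N n = cos x / sin y).
  { apply Rmult_eq_reg_r with (Smod N n * sin y); [|apply Rgt_not_eq, Rmult_lt_0_compat; lra].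
    transitivity (Smod N (S n) * sin y); [field; lra|]. rewrite E; field; lra. }
  rewrite <- ln_div, E' by trivial. unfold lcot; split; apply ln_le.
  - apply Rdiv_lt_0_compat; lra.
  - apply Rmult_le_compat_r; trivial. apply Rlt_le, Rinv_0_lt_compat; lra.
  - apply Rdiv_lt_0_compat; lra.
  - apply Rmult_le_compat_l; [lra|]. apply Rinv_le_contravar; lra.
Qed.

Lemma ln_Smod_lower (N n : nat) : (S n < N)%nat ->
  ang N * ln (Smod N 0) + (lcot_int (ang N * (3/2)) - lcot_int (ang N * (INR n + 3/2)))
  <= ang N * ln (Smod N n).
Proof.
  pose proof (ang_pos N) as Hg.
  induction n as [|n IH]; intros Hn.
  - simpl INR; rewrite Rplus_0_l; lra.
  - specialize (IH ltac:(lia)).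
    destruct (ln_Smod_step N n ltac:(lia)) as [H1 _].
    destruct (angle_range N n ltac:(lia)) as [_ H2].
    destruct (angle_range N (S n) Hn) as [_ H3].
    rewrite S_INR in *.
    destruct (lcot_int_step (ang N * (INR n + 3/2)) (ang N)) as [_ H4]; [lra | lra | nra|].
    replace (ang N * (INR n + 3/2) + ang N) with (ang N * (INR n + 1 + 3/2)) in H4 by ring.
    nra.
Qed.

(** The term [lcot (ang N / 2)] stays outside the integral: comparing it with one would need an
    interval reaching left of 0. *)
Lemma ln_Smod_upper (N n : nat) : (S n < N)%nat ->
  ang N * ln (Smod N (S n))
  <= ang N * ln (Smod N 0) + ang N * lcot (ang N / 2)
     + (lcot_int (ang N / 2) - lcot_int (ang N * (INR n + 1/2))).
Proof.
  pose proof (ang_pos N) as Hg.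
  induction n as [|n IH]; intros Hn;
    destruct (ln_Smod_step N _ Hn) as [_ H1]; destruct (angle_range N _ Hn) as [H2 _].
  - simpl INR in *; rewrite Rplus_0_l in *.
    replace (ang N * (1/2)) with (ang N / 2) in * by field. nra.
  - specialize (IH ltac:(lia)). rewrite S_INR in *.
    destruct (lcot_int_step (ang N * (INR n + 1/2)) (ang N)) as [H4 _].
    + pose proof (pos_INR n); nra.
    + lra.
    + replace (ang N * (INR n + 1/2) + ang N) with (ang N * (INR n + 1 + 1/2)) by ring; lra.
    + replace (ang N * (INR n + 1/2) + ang N) with (ang N * (INR n + 1 + 1/2)) in H4 by ring.
      nra.
Qed.

Lemma ang_bounds (N : nat) : (1 <= N)%nat -> / INR N <= ang N <= 2 / INR N.
Proof.
  intros HN; pose proof PI_bounds.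
  assert (1 <= INR N) by (apply (le_INR 1); lia).
  unfold ang; split; apply Rmult_le_reg_r with (INR N * (2 * INR N + 1)); try nra.
  - apply Rle_trans with (2 * INR N + 1); [apply Req_le; field; lra|].
    apply Rle_trans with (PI * INR N); [nra | apply Req_le; field; lra].
  - apply Rle_trans with (PI * INR N); [apply Req_le; field; lra|].
    apply Rle_trans with (2 * (2 * INR N + 1)); [nra | apply Req_le; field; lra].
Qed.

(** [1/(4N)] would already bound [sin x] from below; 64 matches [Cmod_JW_lower], so that one
    expression [ln (64 * INR N)] serves for all errors. *)
Lemma ln_inv_sin_le (N : nat) (x : R) : (4 <= N)%nat -> ang N / 2 <= x <= ang N ->
  ln (/ sin x) <= ln (64 * INR N).
Proof.
  intros HN Hx. pose proof (ang_bounds N ltac:(lia)) as Hg.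
  assert (HN4 : 4 <= INR N) by (replace 4 with (INR 4) by (simpl; ring); apply le_INR; lia).
  assert (0 < / INR N <= / 4) by (split; [apply Rinv_0_lt_compat | apply Rinv_le_contravar]; lra).
  assert (Hs : / (64 * INR N) <= sin x).
  { apply Rle_trans with (x / 2); [rewrite Rinv_mult; lra | apply sin_ge_half; lra]. }
  assert (0 < / (64 * INR N)) by (apply Rinv_0_lt_compat; lra).
  apply ln_le; [apply Rinv_0_lt_compat; lra|].
  rewrite <- (Rinv_inv (64 * INR N)). apply Rinv_le_contravar; lra.
Qed.

Lemma ln_Smod_0_bounds (N : nat) : (4 <= N)%nat -> 0 <= ln (Smod N 0) <= ln (64 * INR N).
Proof.
  intros HN; pose proof PI_bounds.
  pose proof (ang_bounds N ltac:(lia)) as Hg. pose proof (ang_pos N).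
  assert (HN4 : 4 <= INR N) by (replace 4 with (INR 4) by (simpl; ring); apply le_INR; lia).
  assert (0 < / INR N <= / 4) by (split; [apply Rinv_0_lt_compat | apply Rinv_le_contravar]; lra).
  assert (Hs : 0 < sin (ang N)) by (apply sin_pos_half; lra).
  assert (E : Smod N 0 = cos (ang N / 2) / sin (ang N)).
  { rewrite <- Smod_0; field; lra. }
  pose proof (COS_bound (ang N / 2)).
  assert (sin (ang N) <= cos (ang N / 2)).
  { rewrite <- sin_shift; apply sin_incr_1; lra. }
  rewrite E; split.
  - rewrite <- ln_1; apply ln_le; [lra|].
    apply Rmult_le_reg_r with (sin (ang N)); trivial.
    unfold Rdiv; rewrite Rmult_assoc, Rinv_l by lra; lra.
  - eapply Rle_trans; [|apply (ln_inv_sin_le N (ang N)); trivial; lra].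
    apply ln_le; [apply Rdiv_lt_0_compat; lra|].
    pose proof (Rinv_0_lt_compat _ Hs). unfold Rdiv; nra.
Qed.

Lemma lcot_half_le (N : nat) : (4 <= N)%nat -> lcot (ang N / 2) <= ln (64 * INR N).
Proof.
  intros HN; pose proof PI_bounds.
  pose proof (ang_bounds N ltac:(lia)) as Hg. pose proof (ang_pos N).
  assert (HN4 : 4 <= INR N) by (replace 4 with (INR 4) by (simpl; ring); apply le_INR; lia).
  assert (0 < / INR N <= / 4) by (split; [apply Rinv_0_lt_compat | apply Rinv_le_contravar]; lra).
  assert (Hs : 0 < sin (ang N / 2)) by (apply sin_pos_half; lra).
  assert (0 < cos (ang N / 2)) by (apply cos_pos_half; lra).
  pose proof (COS_bound (ang N / 2)).
  eapply Rle_trans; [|apply (ln_inv_sin_le N (ang N / 2)); trivial; lra].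
  apply ln_le; [apply Rdiv_lt_0_compat; lra|].
  pose proof (Rinv_0_lt_compat _ Hs). unfold Rdiv; nra.
Qed.

(** The prefactor [1 / sin(2g)] lies between 1 and [N]: the lower bound keeps [1/(64N)], the upper
    one becomes [N^2]. *)
Lemma ln_Cmod_JW_bounds (a : Z) (c d : nat) : (1 <= c + d)%nat ->
  exists N0 : nat, forall N, (N0 <= N)%nat -> (4 <= N)%nat ->
  INR (c + d) * ln (Smod N (N / 2)) - ln (64 * INR N)
  <= ln (Cmod (JW a c d N (2 * PI / (INR N + 1/2))))
  <= INR (c + d) * ln (Smod N (N / 2)) + 2 * ln (64 * INR N).
Proof.
  intros Hr; destruct (Cmod_JW_lower a c d Hr) as [N0 H0].
  exists N0; intros N HN HN4. specialize (H0 N HN ltac:(lia)).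
  pose proof (Cmod_JW_upper a c d N ltac:(lia)) as H1.
  set (J := Cmod _) in *. set (s := Smod N (N / 2)) in *. set (r := (c + d)%nat) in *.
  assert (HN4' : 4 <= INR N) by (replace 4 with (INR 4) by (simpl; ring); apply le_INR; lia).
  pose proof PI_bounds. pose proof (ang_bounds N ltac:(lia)) as Hg.
  assert (0 < / INR N <= / 4) by (split; [apply Rinv_0_lt_compat | apply Rinv_le_contravar]; lra).
  assert (Hs : 0 < s) by (apply Smod_pos, Nat.div_lt; lia).
  assert (Hsr : 0 < s ^ r) by (now apply pow_lt).
  assert (Hsin : / INR N <= sin (2 * ang N)).
  { apply Rle_trans with (2 * ang N / 2); [lra | apply sin_ge_half; lra]. }
  pose proof (SIN_bound (2 * ang N)) as Hsin1.
  assert (HA : 0 < s ^ r / (64 * INR N)) by (apply Rdiv_lt_0_compat; lra).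
  assert (HJ0 : 0 <= J) by apply Cmod_ge_0.
  assert (HJ1 : s ^ r / (64 * INR N) <= J) by nra.
  assert (HJ2 : J <= INR N * INR N * s ^ r).
  { apply Rmult_le_reg_r with (/ INR N); [lra|].
    apply Rle_trans with (J * sin (2 * ang N)); [apply Rmult_le_compat_l; lra|].
    replace (INR N * INR N * s ^ r * / INR N) with (INR N * s ^ r) by (field; lra). trivial. }
  rewrite <- ln_pow by trivial. split.
  - rewrite <- ln_div by lra. now apply ln_le.
  - apply Rle_trans with (ln (INR N * INR N * s ^ r)); [apply ln_le; lra|].
    assert (ln (INR N) <= ln (64 * INR N)) by (apply ln_le; lra).
    rewrite (ln_mult (INR N * INR N)), (ln_mult (INR N)) by nra. lra.
Qed.

(** * Passage to the limit *)

Lemma lim_ang_ln : is_lim_seq (fun N => ang N * ln (64 * INR N)) 0.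
Proof.
  apply is_lim_seq_le_le_loc with (fun _ => 0) (fun N => 128 * (ln (64 * INR N) / (64 * INR N))).
  - exists 1%nat; intros N HN.
    assert (1 <= INR N) by (apply (le_INR 1); lia).
    pose proof (ang_bounds N HN) as Hg; pose proof (ang_pos N).
    assert (0 <= ln (64 * INR N)) by (rewrite <- ln_1; apply ln_le; lra).
    split; [apply Rmult_le_pos; lra|].
    apply Rle_trans with (2 / INR N * ln (64 * INR N)); [apply Rmult_le_compat_r; lra|].
    apply Req_le; field; lra.
  - apply is_lim_seq_const.
  - replace (Finite 0) with (Rbar_mult 128 0) by (simpl; f_equal; ring).
    apply is_lim_seq_scal_l.
    apply (is_lim_comp_seq (fun y => ln y / y) (fun N => 64 * INR N) p_infty 0).
    + apply is_lim_div_ln_p.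
    + exists 0%nat; intros; discriminate.
    + replace p_infty with (Rbar_mult 64 p_infty).
      * apply is_lim_seq_scal_l, is_lim_seq_INR.
      * apply is_Rbar_mult_unique, is_Rbar_mult_sym, is_Rbar_mult_p_infty_pos; simpl; lra.
Qed.

Lemma lim_ang : is_lim_seq ang 0.
Proof.
  apply is_lim_seq_le_le_loc with (fun _ => 0) (fun N => 2 * / INR N).
  - exists 1%nat; intros N HN. pose proof (ang_bounds N HN); pose proof (ang_pos N).
    unfold Rdiv in *; lra.
  - apply is_lim_seq_const.
  - replace (Finite 0) with (Rbar_mult 2 (Rbar_inv p_infty)) by (simpl; f_equal; ring).
    apply is_lim_seq_scal_l, is_lim_seq_inv; [apply is_lim_seq_INR | discriminate].
Qed.

Lemma lim_lcot_int_0 (k : R) : 0 < k ->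
  is_lim_seq (fun N => lcot_int (ang N * k)) (2 * RInt lcos 0 (PI / 4)).
Proof.
  intros Hk. eapply filterlim_comp; [|exact lim_RInt_lcot].
  intros P [e He].
  assert (Hek : 0 < e / k) by (apply Rdiv_lt_0_compat; [apply cond_pos | trivial]).
  pose proof lim_ang as Hl. apply is_lim_seq_spec in Hl.
  destruct (Hl (mkposreal _ Hek)) as [N0 HN0].
  exists N0; intros N HN; specialize (HN0 N HN); simpl in HN0.
  pose proof (ang_pos N). rewrite Rminus_0_r, Rabs_pos_eq in HN0 by lra.
  assert (ang N * k < e).
  { apply Rmult_lt_reg_r with (/ k); [now apply Rinv_0_lt_compat|].
    rewrite Rmult_assoc, Rinv_r, Rmult_1_r by lra. exact HN0. }
  apply He; [|nra].
  apply Rabs_lt_between; unfold minus, plus, opp; simpl; nra.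
Qed.

(** [PI/4 = g(N+1/2)/2], so these arguments lie within [kg] of [PI/4], where [lcot_int] is
    continuous and zero. *)
Lemma lim_lcot_int_mid (u : nat -> R) (k : R) :
  eventually (fun N => Rabs (u N - (INR N + 1/2) / 2) <= k) ->
  is_lim_seq (fun N => lcot_int (ang N * u N)) 0.
Proof.
  intros Hu; pose proof PI_bounds.
  replace (Finite 0) with (Finite (lcot_int (PI / 4)))
    by (unfold lcot_int; rewrite RInt_point; reflexivity).
  apply (is_lim_seq_continuous lcot_int).
  - apply continuity_pt_filterlim.
    apply (continuous_RInt_2 (V := R_NormedModule) lcot (PI / 4) (PI / 4)).
    exists (mkposreal (1/2) ltac:(lra)); intros z Hz.
    apply Rabs_lt_between in Hz; unfold minus, plus, opp in Hz; simpl in Hz.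
    apply (RInt_correct (V := R_CompleteNormedModule)), ex_RInt_lcot; lra.
  - apply is_lim_seq_le_le_loc with (fun N => PI / 4 - k * ang N) (fun N => PI / 4 + k * ang N).
    + destruct Hu as [N0 HN0]; exists N0; intros N HN; specialize (HN0 N HN).
      pose proof (ang_pos N); pose proof (ang_spec N).
      apply Rabs_le_between in HN0.
      replace (PI / 4) with (ang N * ((INR N + 1/2) / 2)) by (rewrite <- H1; field).
      nra.
    + replace (Finite (PI / 4)) with (Finite (PI / 4 - k * 0)) by (f_equal; ring).
      apply is_lim_seq_minus'; [apply is_lim_seq_const|].
      apply (is_lim_seq_scal_l ang k 0 lim_ang).
    + replace (Finite (PI / 4)) with (Finite (PI / 4 + k * 0)) by (f_equal; ring).
      apply is_lim_seq_plus'; [apply is_lim_seq_const|].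
      apply (is_lim_seq_scal_l ang k 0 lim_ang).
Qed.

Lemma lim_ln_Smod :
  is_lim_seq (fun N => ang N * ln (Smod N (N / 2))) (2 * RInt lcos 0 (PI / 4)).
Proof.
  set (L := 2 * RInt lcos 0 (PI / 4)).
  assert (Hhalf : forall N, INR N - 1 <= 2 * INR (N / 2) <= INR N).
  { intros N. pose proof (Nat.div_mod_eq N 2). pose proof (Nat.mod_upper_bound N 2 ltac:(lia)).
    replace (2 * INR (N / 2)) with (INR (2 * (N / 2))) by (rewrite mult_INR; simpl; ring).
    assert (INR N <= INR (2 * (N / 2)) + 1) by (rewrite <- S_INR; apply le_INR; lia).
    split; [lra | apply le_INR; lia]. }
  apply is_lim_seq_le_le_loc with
    (fun N => lcot_int (ang N * (3/2)) - lcot_int (ang N * (INR (N / 2) + 3/2)))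
    (fun N => 2 * (ang N * ln (64 * INR N))
       + (lcot_int (ang N * (1/2)) - lcot_int (ang N * (INR (N / 2) - 1/2)))).
  - exists 4%nat; intros N HN. pose proof (ang_pos N).
    pose proof (Nat.div_mod_eq N 2). pose proof (Nat.mod_upper_bound N 2 ltac:(lia)).
    pose proof (ln_Smod_0_bounds N HN). pose proof (lcot_half_le N HN).
    pose proof (ln_Smod_lower N (N / 2) ltac:(lia)) as HL.
    pose proof (ln_Smod_upper N (N / 2 - 1) ltac:(lia)) as HU.
    replace (S (N / 2 - 1)) with (N / 2)%nat in HU by lia.
    rewrite minus_INR in HU by lia; simpl (INR 1) in HU.
    replace (INR (N / 2) - 1 + 1/2) with (INR (N / 2) - 1/2) in HU by field.
    replace (ang N * (1/2)) with (ang N / 2) by field.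
    split; nra.
  - replace (Finite L) with (Finite (L - 0)) by (f_equal; ring).
    apply is_lim_seq_minus'; [apply lim_lcot_int_0; lra|].
    apply (lim_lcot_int_mid (fun N => INR (N / 2) + 3/2) 4).
    exists 0%nat; intros N _; specialize (Hhalf N); apply Rabs_le; lra.
  - replace (Finite L) with (Finite (2 * 0 + (L - 0))) by (f_equal; ring).
    apply is_lim_seq_plus'; [apply (is_lim_seq_scal_l _ 2 0 lim_ang_ln)|].
    apply is_lim_seq_minus'; [apply lim_lcot_int_0; lra|].
    apply (lim_lcot_int_mid (fun N => INR (N / 2) - 1/2) 4).
    exists 0%nat; intros N _; specialize (Hhalf N); apply Rabs_le; lra.
Qed.

Theorem theorem1p11 (a : Z) (c d : nat) (hcd : (1 <= c + d)%nat) :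
  is_lim_seq
    (fun N : nat =>
       2 * PI / (INR N + 1/2) * ln (Cmod (JW a c d N (2 * PI / (INR N + 1/2)))))
    (VolW a c d).
Proof.
  destruct (ln_Cmod_JW_bounds a c d hcd) as [N0 H0].
  set (r := INR (c + d)) in *.
  set (L := 2 * RInt lcos 0 (PI / 4)).
  assert (HV : VolW a c d = 4 * r * L) by (unfold VolW; rewrite v8_eq; unfold L, r; ring).
  rewrite HV.
  (* The prefactor is [4g]; it multiplies the errors [-ln (64 N)] and [2 ln (64 N)]. *)
  apply is_lim_seq_le_le_loc with
    (fun N => 4 * r * (ang N * ln (Smod N (N / 2))) + -4 * (ang N * ln (64 * INR N)))
    (fun N => 4 * r * (ang N * ln (Smod N (N / 2))) + 8 * (ang N * ln (64 * INR N))).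
  - exists (N0 + 4)%nat; intros N HN.
    specialize (H0 N ltac:(lia) ltac:(lia)).
    set (X := ln (Cmod _)) in *.
    replace (2 * PI / (INR N + 1/2)) with (4 * ang N)
      by (unfold ang; field; pose proof (pos_INR N); lra).
    pose proof (ang_pos N) as Hg.
    assert (Hg4 : 0 <= 4 * ang N) by lra.
    pose proof (Rmult_le_compat_l _ _ _ Hg4 (proj1 H0)).
    pose proof (Rmult_le_compat_l _ _ _ Hg4 (proj2 H0)).
    lra.
  - replace (Finite (4 * r * L)) with (Finite (4 * r * L + -4 * 0)) by (f_equal; ring).
    apply is_lim_seq_plus';
      [apply (is_lim_seq_scal_l _ (4 * r) L lim_ln_Smod) | apply (is_lim_seq_scal_l _ (-4) 0 lim_ang_ln)].
  - replace (Finite (4 * r * L)) with (Finite (4 * r * L + 8 * 0)) by (f_equal; ring).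
    apply is_lim_seq_plus';
      [apply (is_lim_seq_scal_l _ (4 * r) L lim_ln_Smod) | apply (is_lim_seq_scal_l _ 8 0 lim_ang_ln)].
Qed.
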